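(* The Hermite polynomials $He_n(x)$ have the following three approximations as $n\to\infty$ when $x=O(\sqrt n)$ and $x>0$. 1. (Small-$x$ regime, $0<x<2\sqrt n$.) For fixed $a\in(0,1)$, set $x=2a\sqrt n$. Then, with the convention $\arccos(a)\in(0,\pi)$, $$He_n(2a\sqrt n)=n^{n/2}\,\frac{\sqrt2}{(1-a^2)^{1/4}}\,e^{n(a^2-1/2)}\,\cos\Big(n\big(a\sqrt{1-a^2}-\arccos(a)\big)-\tfrac12\big(\arccos(a)+\tfrac{\pi}{2}\big)\Big)\,(1+o(1)).$$ Equivalently, writing $a=\cos(\alpha)$ with $\alpha\in(0,\pi/2)$, $$He_n(2\cos(\alpha)\sqrt n)=n^{n/2}\sqrt{\frac{2}{\sin(\alpha)}}\;e^{n(\cos^2\alpha-1/2)}\,\cos\Big(n(\sin\alpha\cos\alpha-\alpha)-\tfrac12\big(\alpha+\tfrac\pi2\big)\Big)\,(1+o(1)).$$ 2. (Large-$x$ regime, $x>2\sqrt n$.) For fixed $a>1$, write $a=\cosh(\gamma)$ with $\gamma\ge0$ and set $x=2a\sqrt n$. Then $$He_n(2a\sqrt n)=He_n(2\cosh(\gamma)\sqrt n)=n^{n/2}\,e^{n(\gamma+\frac12e^{-2\gamma})}\,\frac{e^{\gamma/2}}{\sqrt{2\sinh(\gamma)}}\,(1+o(1)).$$ 3. (Edge regime, $x=2\sqrt n+O(n^{-1/6})$.) For fixed $u\in\mathbb{R}$, set $x=2\sqrt n+n^{-1/6}u$. Then $$He_n\big(2\sqrt n+n^{-1/6}u\b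ig)=\sqrt{2\pi}\,e^{n/2}\,n^{n/2}\,n^{1/6}\,e^{un^{1/3}}\,\mathrm{Ai}(u)\,(1+o(1)).$$
   Context: $He_n(x)=\mathbb{E}_{Z\sim\mathcal{N}(0,1)}[(x+\imath Z)^n]=\int_{-\infty}^\infty (x+\imath z)^n\frac{1}{\sqrt{2\pi}}e^{-z^2/2}\,dz$ is the probabilist's Hermite polynomial ($\imath=\sqrt{-1}$). The notation $f(n)=g(n)(1+o(1))$ means $\lim_{n\to\infty}f(n)/g(n)=1$; the asymptotics are pointwise, i.e. the parameters $a,\alpha,\gamma,u$ are held fixed while $n\to\infty$. $\mathrm{Ai}$ is the (standard) Airy function, $\mathrm{Ai}(u)=\frac{1}{2\pi\imath}\int_{\mathcal C}\exp\{\frac{t^3}{3}-ut\}\,dt$, where $\mathcal C$ is the union of the two infinite rays from the origin making angles $\pi/3$ and $-\pi/3$ with the positive real axis.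
   Formalization: In part 1 (both forms) the phase −½(arccos a+π/2) is corrected to −½(arccos a−π/2), and (1+o(1)) means error o(amplitude) plus ratio→1 along n with |cos|≥δ; in part 3 ratio→1 is claimed only if Ai(u)≠0, with He_n/prefactor→Ai(u) for every u. *)

(* Defs.v *)
From mathcomp Require Export all_boot all_order all_algebra.
From mathcomp Require Export all_classical all_reals all_analysis.
From mathcomp Require Export measurable_realfun complex.
From mathcomp Require Import ring lra.

Set Implicit Arguments.
Unset Strict Implicit.
Unset Printing Implicit Defensive.

Export Order.TTheory GRing.Theory Num.Theory.
Export numFieldNormedType.Exports.

Local Open Scope classical_set_scope.
Local Open Scope ring_scope.
Local Open Scope complex_scope.

Section definitions.
Context {R : realType}.

Definition cexp (w : R[i]) : R[i] :=
  (expR (complex.Re w))%:C * (cos (complex.Im w) +i* sin (complex.Im w)).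

Definition Cintegral (D : set R) (f : R -> R[i]) : R[i] :=
  (\int[lebesgue_measure]_(t in D) complex.Re (f t)) +i*
  (\int[lebesgue_measure]_(t in D) complex.Im (f t)).

(* The integral of f along the ray s |-> s e^(i theta), 0 <= s, directed away
   from the origin. *)
Definition ray_integral (theta : R) (f : R[i] -> R[i]) : R[i] :=
  Cintegral `[0, +oo[ (fun s => f (s%:C * cexp (theta *i)) * cexp (theta *i)).

(* HeC and AiC are real-valued, see HeE and AiE below. *)
Definition HeC (n : nat) (x : R) : R[i] :=
  Cintegral setT (fun z : R => (x +i* z) ^+ n * (normal_pdf 0 1 z)%:C).

Definition He (n : nat) (x : R) : R := complex.Re (HeC n x).

(* The contour comes from infinity along the ray of angle - pi / 3 and leaves
   along the ray of angle pi / 3. *)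
Definition AiC (u : R) : R[i] :=
  ((2 * pi) *i)^-1 *
  (ray_integral (pi / 3) (fun t => cexp (t ^+ 3 / 3 - u%:C * t)) -
   ray_integral (- (pi / 3)) (fun t => cexp (t ^+ 3 / 3 - u%:C * t))).

Definition Ai (u : R) : R := complex.Re (AiC u).

Definition cosh (x : R) : R := (expR x + expR (- x)) / 2.
Definition sinh (x : R) : R := (expR x - expR (- x)) / 2.

(* f n = g n * (1 + o(1)) along F. *)
Definition asymp_eq (F : set_system nat) (f g : nat -> R) : Prop :=
  f n / g n @[n --> F] --> (1 : R).

(* f n = A n * c n * (1 + o(1)) for an amplitude A and an oscillating factor c.
   When c comes arbitrarily close to 0, the ratio f / (A * c) need not converge,
   because the zeros of f are only close to those of c. The relation therefore
   means that the error is o(A n), and that f is asymptotic to A * c along the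
   indices at which c stays away from 0. *)
Definition osc_asymp_eq (f A c : nat -> R) : Prop :=
  (f n / A n - c n @[n --> \oo] --> (0 : R)) /\
  (forall delta : R, 0 < delta ->
     asymp_eq (within [set n | delta <= `|c n|] \oo) f (fun n => A n * c n)).

End definitions.

Section basic_facts.
Context {R : realType}.
Local Notation mu := (@lebesgue_measure R).

Let integral_reflect (f : R -> \bar R) : measurable_fun [set: R] f ->
  (forall x, 0 <= f x)%E ->
  (\int[mu]_x f (- x)%R = \int[mu]_x f x)%E.
Proof.
move=> mf f0; rewrite -(preimage_setT (-%R : R -> measurableTypeR R)).
rewrite -[LHS]/(\int[mu]_(x in _) (f \o (-%R : R -> measurableTypeR R)) x)%E.
rewrite -ge0_integral_pushforward//=.
by apply: eq_measure_integral => //= A mA _; exact: lebesgue_measureN.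
Qed.

Let Rintegral_opp (D : set R) (f : R -> R) :
  \int[mu]_(t in D) (- f t) = - \int[mu]_(t in D) f t.
Proof.
rewrite /Rintegral integralE [in RHS]integralE.
have -> : (fun t => (- f t)%:E) = (\- (EFin \o f))%E by [].
rewrite funeposN funenegN.
by case: (integral _ _ _) => [a| |]; case: (integral _ _ _) => [b| |] //=;
  rewrite ?oppr0 ?opprB ?oppr0.
Qed.

Let Rintegral_odd (f : R -> R) : measurable_fun [set: R] f ->
  (forall t, f (- t) = - f t) -> \int[mu]_t f t = 0.
Proof.
move=> mf oddf; rewrite /Rintegral.
have mF : measurable_fun [set: R] (EFin \o f) by exact/measurable_EFinP.
rewrite integralE -(integral_reflect (measurable_funeneg mF))//.
have -> : (fun t => (EFin \o f)^\- (- t)%R)%E = ((EFin \o f)^\+)%E.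
  by apply/funext => t; rewrite funenegE funeposE /= oddf opprK.
by case: (integral _ _ _) => [a| |] //=; rewrite subrr.
Qed.

Let measurable_ReIm (x : R) n :
  measurable_fun [set: R] (fun z : R => complex.Re ((x +i* z) ^+ n)) /\
  measurable_fun [set: R] (fun z : R => complex.Im ((x +i* z) ^+ n)).
Proof.
elim: n => [|n [mRe mIm]]; first by split; exact: measurable_cst.
have eRe z : complex.Re ((x +i* z) ^+ n.+1) =
    x * complex.Re ((x +i* z) ^+ n) - z * complex.Im ((x +i* z) ^+ n).
  by rewrite exprS; case: (_ ^+ n).
have eIm z : complex.Im ((x +i* z) ^+ n.+1) =
    x * complex.Im ((x +i* z) ^+ n) + z * complex.Re ((x +i* z) ^+ n).
  by rewrite exprS; case: (_ ^+ n).
split.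
  under eq_fun do rewrite eRe.
  by apply: measurable_funB; apply: measurable_funM.
under eq_fun do rewrite eIm.
by apply: measurable_funD; apply: measurable_funM.
Qed.

Lemma HeE n (x : R) : (He n x)%:C = HeC n x.
Proof.
rewrite /He /HeC /Cintegral /=; congr Complex; apply/esym.
have eIm z : complex.Im ((x +i* z) ^+ n * (normal_pdf 0 1 z)%:C) =
    complex.Im ((x +i* z) ^+ n) * normal_pdf 0 1 z.
  by case: (_ ^+ n) => a b /=; rewrite mulr0 add0r.
under eq_Rintegral do rewrite eIm.
apply: Rintegral_odd.
  apply: measurable_funM; first exact: (measurable_ReIm x n).2.
  exact: measurable_normal_pdf.
move=> t; have -> : x +i* (- t) = (x +i* t)^* by [].
rewrite -rmorphXn /=; have -> : normal_pdf 0 1 (- t) = normal_pdf 0 1 t :> R.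
  by rewrite /normal_pdf oner_eq0 /normal_fun !subr0 sqrrN.
by case: (_ ^+ n) => a b /=; rewrite mulNr.
Qed.

Let cexp_conj (w : R[i]) : cexp (conjc w) = conjc (cexp w).
Proof. by case: w => a b; rewrite /cexp/= cosN sinN; simpc. Qed.

Let Cintegral_conj D (f : R -> R[i]) :
  Cintegral D (fun t => conjc (f t)) = conjc (Cintegral D f).
Proof.
rewrite /Cintegral /=; congr Complex.
  by apply: eq_Rintegral => t _; case: (f t).
by rewrite -Rintegral_opp; apply: eq_Rintegral => t _; case: (f t).
Qed.

Lemma AiE (u : R) : (Ai u)%:C = AiC u.
Proof.
rewrite /Ai /AiC; set f := fun t => _.
have eC (a : R) : conjc a%:C = a%:C by rewrite /= oppr0.
have eM (a b : R[i]) : conjc (a * b) = conjc a * conjc b by exact: rmorphM.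
have fconj t : f (conjc t) = conjc (f t).
  have e3 : conjc 3^-1 = 3^-1 :> R[i] by rewrite (fmorphV (@conjc R)) rmorph_nat.
  have eB (a b : R[i]) : conjc (a - b) = conjc a - conjc b by exact: rmorphB.
  have eX (a : R[i]) : conjc (a ^+ 3) = conjc a ^+ 3 by exact: rmorphXn.
  by rewrite /f -cexp_conj eB (eM (t ^+ 3)) eX (eM u%:C) e3 eC.
have -> : ray_integral (- (pi / 3)) f = conjc (ray_integral (pi / 3) f).
  rewrite /ray_integral -Cintegral_conj; congr Cintegral; apply/funext => s.
  have -> : (- (pi / 3)) *i = conjc ((pi / 3) *i) :> R[i] by [].
  by rewrite cexp_conj -{1}(eC s) -eM fconj -eM.
case: (ray_integral _ _) => a b; simpc => /=.
by congr Complex; rewrite !(mul0r, mulr0, oppr0, subrr, addr0, add0r).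
Qed.

Lemma cosh_surj (x : R) : 1 <= x -> exists2 gamma, 0 <= gamma & x = cosh gamma.
Proof.
move=> x1; set d := Num.sqrt (x ^+ 2 - 1).
have d2 : d ^+ 2 = x ^+ 2 - 1 by rewrite sqr_sqrtr// subr_ge0 expr_ge1//; lra.
have d0 : 0 <= d by exact: sqrtr_ge0.
have p : 0 < x + d by lra.
exists (ln (x + d)); first by apply: ln_ge0; lra.
rewrite /cosh expRN lnK ?posrE//.
have -> : (x + d)^-1 = x - d.
  by apply: (mulfI (lt0r_neq0 p)); rewrite divff ?lt0r_neq0// mulrC -subr_sqr d2; ring.
by field.
Qed.

End basic_facts.

(* Main.v *)
Require Import Defs.
From mathcomp Require Import ring lra.

(** The proof is the method of steepest descent, on contours chosen so that the
    saddle points are met by explicit rays.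

    The expectation is a contour integral,
    [He n x = (1 / (i sqrt (2 pi))) \int w ^+ n * exp ((w - x) ^+ 2 / 2) dw]
    along the vertical line through [x]. The integrand takes conjugate values at
    conjugate points, so the upper half of the line determines the integral. It is
    entire, real on the real axis, and decays like a Gaussian in the directions
    [zeta] of the cone [|Re zeta| < Im zeta]. The half-line may therefore be
    replaced by any ray [c + s * zeta], [0 <= s], with [c] real and [zeta] in the
    cone: the piece of the real axis between [x] and [c] contributes a real number,
    which does not affect the imaginary part ([He_hermite_ray]). The deformation is
    carried out on real integrals: along a linear homotopy of rays the derivative
    of the integrand in the homotopy parameter is an exact derivative along the ray
    ([homotopy_Rintegral], [hermite_ray_invariant]). With [n = 0], the same
    invariance evaluates the complex Gaussian integrals that occur as limits
    ([Cintegral_gauss_ray]).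

    Put [q = sqrt n] and [w = q * w0 * (1 + v)], [x = q * (w0 + w0^-1) + r].
    The exponent then has no term of first order in [v] ([saddle_factor]), and
    [(1 + v) ^+ n] is [exp (n * (v - v ^+ 2 / 2 + v ^+ 3 / 3))] up to a factor
    tending to 1 as soon as [n * |v| ^+ 4] tends to 0 ([ccvg_log_remainder]).
    This gives the pointwise limit of the integrand in each regime, and
    dominated convergence gives the limit of the integral:

    - for [x = 2 cosh gamma q] the saddle is [w0 = exp gamma], the vertical ray
      starts at it, and the limit is a real Gaussian ([He_asymp_outside]);

    - for [x = 2 cos alpha q] the saddle is [w0 = exp (i alpha)], it lies on the
      vertical ray starting at [q cos alpha], and the limit is a complex Gaussian
      on the whole line, multiplied by a factor of modulus one whose phase
      depends on [n] and produces the cosine ([He_asymp_inside]);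

    - for [x = 2 q + u / h], [h = n ^ (1 / 6)], the saddles merge at [w0 = 1], the
      quadratic terms cancel and the cubic term remains. The direction
      [exp (i pi / 3)] of the ray is that of the contour defining the Airy
      function, so that the limit integrand is the Airy integrand itself
      ([He_asymp_edge]).

    In the last two regimes the domination comes from lower bounds for [exp] that
    improve on [1 + y <= exp y] ([expR_ge1D_quadratic], [edge_modulus_bound]). *)

Set Implicit Arguments.
Unset Strict Implicit.
Unset Printing Implicit Defensive.

Local Open Scope classical_set_scope.
Local Open Scope ring_scope.

Local Notation normc := ComplexField.Normc.normc.
Local Notation Re := (@complex.Re _).
Local Notation Im := (@complex.Im _).

(** * The complex exponential and curves in the complex plane *)

Section complex_calculus.
Context {R : realType}.
Local Open Scope complex_scope.
Implicit Types (z w : R[i]) (f g : R -> R[i]) (t : R).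

Lemma invC2 : (2 : R[i])^-1 = (2^-1)%:C.
Proof. by rewrite fmorphV rmorph_nat. Qed.

Lemma ReD z w : Re (z + w) = Re z + Re w. Proof. by case: z w => [? ?] []. Qed.

Lemma ImD z w : Im (z + w) = Im z + Im w. Proof. by case: z w => [? ?] []. Qed.

Lemma ReM z w : Re (z * w) = Re z * Re w - Im z * Im w.
Proof. by case: z w => [? ?] []. Qed.

Lemma ImM z w : Im (z * w) = Re z * Im w + Im z * Re w.
Proof. by case: z w => [? ?] []. Qed.

Lemma cexpD z w : cexp (z + w) = cexp z * cexp w.
Proof.
case: z w => [a b] [c d]; rewrite /cexp /= expRD cosD sinD; simpc.
by congr Complex; ring.
Qed.

Lemma cexp0 : cexp 0 = 1 :> R[i].
Proof. by rewrite /cexp /= expR0 cos0 sin0; simpc. Qed.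

Lemma cexpR (x : R) : cexp x%:C = (expR x)%:C.
Proof. by rewrite /cexp /= cos0 sin0; simpc. Qed.

Lemma cexpX z n : cexp z ^+ n = cexp (n%:R * z).
Proof.
elim: n => [|n ih]; first by rewrite expr0 mul0r cexp0.
by rewrite exprS ih -cexpD -{1}(mul1r z) -mulrDl -natr1 addrC.
Qed.

Lemma normc_ge0 z : 0 <= normc z.
Proof. by case: z => a b; exact: sqrtr_ge0. Qed.

Lemma normc_real (x : R) : normc x%:C = `|x|.
Proof. by rewrite /= expr0n addr0 sqrtr_sqr. Qed.

Lemma normc_nat n : normc n%:R = n%:R :> R.
Proof. by rewrite -(rmorph_nat (real_complex R)) normc_real ger0_norm. Qed.

Lemma normcM z w : normc (z * w) = normc z * normc w.
Proof. exact: ComplexField.Normc.normcM. Qed.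

Lemma normcX z n : normc (z ^+ n) = normc z ^+ n.
Proof.
elim: n => [|n ih]; first by rewrite !expr0 ComplexField.Normc.normc1.
by rewrite !exprS normcM ih.
Qed.

Lemma normc_cexp z : normc (cexp z) = expR (Re z).
Proof.
rewrite /cexp normcM normc_real ger0_norm ?expR_ge0//=.
by rewrite cos2Dsin2 sqrtr1 mulr1.
Qed.

Lemma Re_le_normc z : `|Re z| <= normc z.
Proof.
by case: z => a b /=; rewrite -sqrtr_sqr ler_wsqrtr// lerDl sqr_ge0.
Qed.

Lemma Im_le_normc z : `|Im z| <= normc z.
Proof.
by case: z => a b /=; rewrite -sqrtr_sqr ler_wsqrtr// lerDr sqr_ge0.
Qed.

Lemma normc_le_ReIm z : normc z <= `|Re z| + `|Im z|.
Proof.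
rewrite [in leLHS](complexE z) (le_trans (le_normcD _ _))// normcM !normc_real.
by rewrite /= expr0n expr1n add0r sqrtr1 mul1r.
Qed.

Lemma normc_sqr z : normc z ^+ 2 = Re z ^+ 2 + Im z ^+ 2.
Proof. by case: z => a b /=; rewrite sqr_sqrtr// addr_ge0 ?sqr_ge0. Qed.

(** Curves are differentiated on their real coordinates, where the chain rule for
    functions of a real variable is available. *)
Definition is_cderive f t (d : R[i]) : Prop :=
  is_derive t 1 (Re \o f) (Re d) /\ is_derive t 1 (Im \o f) (Im d).

Lemma is_cderive_eq f t d d' : is_cderive f t d -> d = d' -> is_cderive f t d'.
Proof. by move=> + <-. Qed.

Lemma is_cderive_cst z t : is_cderive (fun=> z) t 0.
Proof. by split => /=; exact: is_derive_cst. Qed.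

Lemma is_cderive_real (f : R -> R) t d :
  is_derive t 1 f d -> is_cderive (fun t => (f t)%:C) t d%:C.
Proof. by split => //=; exact: is_derive_cst. Qed.

Lemma is_cderive_id t : is_cderive (fun t => t%:C) t 1.
Proof. exact: (is_cderive_real (is_derive_id t 1)). Qed.

Lemma is_cderiveD f g t d e : is_cderive f t d -> is_cderive g t e ->
  is_cderive (fun t => f t + g t) t (d + e).
Proof.
move=> [f1 f2] [g1 g2]; split; rewrite ?ReD ?ImD.
- have -> : Re \o (fun t => f t + g t) = (Re \o f) + (Re \o g).
    by apply/funext => s /=; rewrite ReD.
  exact: is_deriveD.
- have -> : Im \o (fun t => f t + g t) = (Im \o f) + (Im \o g).
    by apply/funext => s /=; rewrite ImD.
  exact: is_deriveD.
Qed.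

Lemma is_cderiveM f g t d e : is_cderive f t d -> is_cderive g t e ->
  is_cderive (fun t => f t * g t) t (d * g t + f t * e).
Proof.
move=> [f1 f2] [g1 g2]; split; rewrite ?ReD ?ImD ?ReM ?ImM.
- have -> : Re \o (fun t => f t * g t) =
      (Re \o f) * (Re \o g) - (Im \o f) * (Im \o g).
    by apply/funext => s /=; rewrite ReM.
  apply: is_derive_eq; rewrite /GRing.scale /=; ring.
- have -> : Im \o (fun t => f t * g t) =
      (Re \o f) * (Im \o g) + (Im \o f) * (Re \o g).
    by apply/funext => s /=; rewrite ImM.
  apply: is_derive_eq; rewrite /GRing.scale /=; ring.
Qed.

Lemma is_cderiveX f t d n : is_cderive f t d ->
  is_cderive (fun t => f t ^+ n) t (n%:R * f t ^+ n.-1 * d).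
Proof.
move=> df; elim: n => [|n ih].
  by apply: is_cderive_eq; [exact: is_cderive_cst|rewrite mul0r mul0r].
have -> : (fun t => f t ^+ n.+1) = (fun t => f t * f t ^+ n).
  by apply/funext => s; rewrite exprS.
apply: is_cderive_eq; first exact: is_cderiveM df ih.
case: n {ih} => [|n] /=; first by rewrite expr0; ring.
by rewrite exprS -[n.+2%:R]natr1; ring.
Qed.

Lemma is_cderive_cexp f t d : is_cderive f t d ->
  is_cderive (fun t => cexp (f t)) t (d * cexp (f t)).
Proof.
move=> [f1 f2].
have e1 : is_derive t 1 (expR \o (Re \o f)) (expR (Re (f t)) * Re d).
  exact: is_derive1_comp.
have e2 : is_derive t 1 (cos \o (Im \o f)) (- sin (Im (f t)) * Im d).
  exact: is_derive1_comp.
have e3 : is_derive t 1 (sin \o (Im \o f)) (cos (Im (f t)) * Im d).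
  exact: is_derive1_comp.
have c1 : is_cderive (fun s => (expR (Re (f s)))%:C) t
    ((expR (Re (f t)) * Re d)%:C) by exact: is_cderive_real.
have c2 : is_cderive (fun s => cos (Im (f s)) +i* sin (Im (f s))) t
    ((- sin (Im (f t)) * Im d) +i* (cos (Im (f t)) * Im d)) by split.
apply: is_cderive_eq; first exact: (is_cderiveM c1 c2).
rewrite /cexp {f1 f2 c1 c2 e1 e2 e3}; case: d (f t) => [a b] [x y] /=; simpc.
by congr Complex; ring.
Qed.

Lemma is_cderive_affine (a b : R[i]) (t : R) :
  is_cderive (fun t : R => a + t%:C * b) t b.
Proof.
apply: is_cderive_eq; first exact: (is_cderiveD (is_cderive_cst a t)
  (is_cderiveM (is_cderive_id t) (is_cderive_cst b t))).
by rewrite add0r mulr0 mul1r addr0.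
Qed.

Definition ccontinuous f : Prop :=
  continuous (Re \o f) /\ continuous (Im \o f).

Lemma ccontinuous_cst z : ccontinuous (fun=> z).
Proof. by split => t; exact: cvg_cst. Qed.

Lemma ccontinuous_real (f : R -> R) :
  continuous f -> ccontinuous (fun t => (f t)%:C).
Proof. by split => //= t; exact: cvg_cst. Qed.

Lemma ccontinuousD f g : ccontinuous f -> ccontinuous g ->
  ccontinuous (fun t => f t + g t).
Proof.
move=> [f1 f2] [g1 g2]; split.
- have -> : Re \o (fun t => f t + g t) = (Re \o f) \+ (Re \o g).
    by apply/funext => s /=; rewrite ReD.
  by move=> t; apply: continuousD; [exact: f1|exact: g1].
- have -> : Im \o (fun t => f t + g t) = (Im \o f) \+ (Im \o g).
    by apply/funext => s /=; rewrite ImD.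
  by move=> t; apply: continuousD; [exact: f2|exact: g2].
Qed.

Lemma ccontinuousM f g : ccontinuous f -> ccontinuous g ->
  ccontinuous (fun t => f t * g t).
Proof.
move=> [f1 f2] [g1 g2]; split.
- have -> : Re \o (fun t => f t * g t) =
      ((Re \o f) \* (Re \o g)) \- ((Im \o f) \* (Im \o g)).
    by apply/funext => s /=; rewrite ReM.
  by move=> t; apply: continuousB; apply: continuousM;
    [exact: f1|exact: g1|exact: f2|exact: g2].
- have -> : Im \o (fun t => f t * g t) =
      ((Re \o f) \* (Im \o g)) \+ ((Im \o f) \* (Re \o g)).
    by apply/funext => s /=; rewrite ImM.
  by move=> t; apply: continuousD; apply: continuousM;
    [exact: f1|exact: g2|exact: f2|exact: g1].
Qed.

Lemma ccontinuousX f n : ccontinuous f -> ccontinuous (fun t => f t ^+ n).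
Proof.
move=> cf; elim: n => [|n ih].
  by under eq_fun do rewrite expr0; exact: ccontinuous_cst.
by under eq_fun do rewrite exprS; exact: ccontinuousM.
Qed.

Lemma ccontinuous_cexp f : ccontinuous f -> ccontinuous (fun t => cexp (f t)).
Proof.
move=> [f1 f2]; apply: ccontinuousM.
  apply: ccontinuous_real => t; apply: continuous_comp; first exact: f1.
  exact: continuous_expR.
by split => t; apply: (continuous_comp (f2 t));
  [exact: continuous_cos|exact: continuous_sin].
Qed.

End complex_calculus.

(** * Integrals of real functions *)

Section real_integrals.
Context {R : realType}.
Local Notation mu := (@lebesgue_measure R).
Local Notation halfline := `[0%R, +oo[%classic.

Lemma dominated_Rintegral_cvg (D : set R) (f_ : nat -> R -> R) (f g : R -> R) :
  measurable D -> (forall n, measurable_fun D (f_ n)) ->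
  (forall x, D x -> f_ n x @[n --> \oo] --> f x) ->
  mu.-integrable D (EFin \o g) ->
  (forall n x, D x -> `|f_ n x| <= g x) ->
  \int[mu]_(x in D) f_ n x @[n --> \oo] --> \int[mu]_(x in D) f x.
Proof.
move=> mD mf ff ig fg; apply: fine_cvg.
have mF n : measurable_fun D (EFin \o f_ n) by exact/measurable_EFinP.
have cF x : D x -> (f_ n x)%:E @[n --> \oo] --> (f x)%:E.
  by move=> Dx; apply: cvg_EFin; [exact: nearW|exact: ff].
have mf' : measurable_fun D (EFin \o f).
  exact: (@emeasurable_fun_cvg _ _ _ _ (fun n => EFin \o f_ n) _ mF cF).
have [||iF _ cI] := @dominated_convergence _ _ _ mu D mD
  (fun n => EFin \o f_ n) (EFin \o f) (EFin \o g) mF mf' _ ig _.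
- exact/aeW/cF.
- by apply: aeW => x n Dx; rewrite lee_fin fg.
by rewrite fineK//; exact: integrable_fin_num.
Qed.

Lemma continuous_measurable_in (D : set R) (f : R -> R) :
  continuous f -> measurable_fun D f.
Proof. by move=> cf; apply: measurable_funTS; exact: continuous_measurable_fun. Qed.

Lemma is_derive_expRN (C s : R) :
  is_derive s 1 (fun s => - C * expR (- s)) (C * expR (- s)).
Proof.
have e1 : is_derive s 1 (expR \o -%R) (expR (- s) * - 1) by exact: is_derive1_comp.
have := is_deriveZ (- C) e1; rewrite /GRing.scale /= => e2.
by apply: is_derive_eq; rewrite mulrN1 mulrN mulNr opprK.
Qed.

Lemma cvg_expRN (C : R) : C * expR (- s) @[s --> +oo] --> (0 : R).
Proof.
rewrite -[0](mulr0 C); apply: cvgM; first exact: cvg_cst.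
exact: cvgr_expR.
Qed.

Lemma continuous_expRN (C : R) : continuous (fun s : R => C * expR (- s)).
Proof.
move=> s; apply: cvgM; first exact: cvg_cst.
by apply: (@continuous_comp _ _ _ -%R expR);
  [exact: opp_continuous|exact: continuous_expR].
Qed.

Lemma integral_expRN (C : R) : 0 <= C ->
  (\int[mu]_(s in halfline) (C * expR (- s))%:E = C%:E)%E.
Proof.
move=> C0.
rewrite (@ge0_continuous_FTC2y _ _ (fun s => - C * expR (- s)) 0 0).
- by rewrite oppr0 expR0 mulr1 sub0e -EFinN opprK.
- by move=> s _; rewrite mulr_ge0 ?expR_ge0.
- exact/continuous_subspaceT/continuous_expRN.
- exact: cvg_expRN.
- by move=> s _; have [] := is_derive_expRN C s.
- exact/cvg_at_right_filter/continuous_expRN.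
- by move=> s _; rewrite derive1E; have [] := is_derive_expRN C s.
Qed.

Lemma integrable_expRN (C : R) : 0 <= C ->
  mu.-integrable halfline (EFin \o (fun s => C * expR (- s))).
Proof.
move=> C0; apply/integrableP; split.
  by apply/measurable_EFinP; apply: continuous_measurable_in; exact: continuous_expRN.
apply: le_lt_trans (ltry C); rewrite -[leRHS]integral_expRN// le_eqVlt.
apply/orP; left; apply/eqP/eq_integral => s _ /=.
by rewrite ger0_norm ?mulr_ge0 ?expR_ge0.
Qed.

Lemma integrable_dominated (C : R) (f : R -> R) : 0 <= C -> continuous f ->
  (forall s : R, 0 <= s -> `|f s| <= C * expR (- s)) ->
  mu.-integrable halfline (EFin \o f).
Proof.
move=> C0 cf fC; apply: le_integrable (integrable_expRN C0) => //.
  by apply/measurable_EFinP; exact: continuous_measurable_in.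
move=> s /=; rewrite in_itv/= andbT => s0; rewrite lee_fin.
by rewrite [leRHS]ger0_norm ?fC// mulr_ge0 ?expR_ge0.
Qed.

(** Adding the derivative of [- C * expR (- s)] to [f] makes the integrand
    nonnegative, the case in which monotone convergence gives the fundamental
    theorem on an unbounded interval. *)
Lemma Rintegral_halfline_FTC (C : R) (f F : R -> R) : 0 <= C ->
  continuous f -> (forall s : R, is_derive s 1 F (f s)) ->
  (forall s : R, 0 <= s -> `|f s| <= C * expR (- s)) ->
  (forall s : R, 0 <= s -> `|F s| <= C * expR (- s)) ->
  \int[mu]_(s in halfline) f s = - F 0.
Proof.
move=> C0 cf dF fC FC.
have i1 := integrable_dominated C0 cf fC.
have i2 := integrable_expRN C0.
pose G s := F s + - C * expR (- s).
have dG (s : R) : is_derive s 1 G (f s + C * expR (- s)).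
  have e := is_derive_expRN C s; exact: is_deriveD.
have cF : continuous F.
  by move=> s; apply/differentiable_continuous/derivable1_diffP; have [] := dF s.
have cG : continuous G.
  by move=> s; apply/differentiable_continuous/derivable1_diffP; have [] := dG s.
have h : \int[mu]_(s in halfline) (f s + C * expR (- s)) = 0 - G 0.
  apply: Rintegral_ge0_continuous_FTC2y.
  - move=> s s0; have := fC _ s0; rewrite ler_norml => /andP[]; lra.
  - apply: continuous_subspaceT => s; apply: cvgD; first exact: cf.
    exact: continuous_expRN.
  - rewrite -[0]addr0; apply: cvgD; last exact: cvg_expRN.
    apply: (@squeeze_cvgr _ _ _ _ (fun s => - C * expR (- s)) (fun s => C * expR (- s))).
    + near=> s; rewrite mulNr -ler_norml FC//; near: s; exact: nbhs_pinfty_ge.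
    + exact: cvg_expRN.
    + exact: cvg_expRN.
  - by move=> s _; have [] := dG s.
  - exact/cvg_at_right_filter/cG.
  - by move=> s _; rewrite derive1E; have [] := dG s.
move: h; rewrite RintegralD// {2}/Rintegral integral_expRN//=.
by rewrite /G oppr0 expR0 => /(canRL (addrK _)) ->; ring.
Unshelve. all: by end_near. Qed.

(** If moving the parameter changes the integrand by an exact derivative in [s],
    whose primitive vanishes at both ends, then the integral does not move. The
    parameter is run through the square of a sine, so that it stays in [0, 1] on
    the whole line and no one-sided derivative is needed at the endpoints. *)
Lemma homotopy_Rintegral (C : R) (f g d : R -> R -> R) : 0 <= C ->
  (forall p s : R, is_derive p 1 (f ^~ s) (d p s)) ->
  (forall p s : R, is_derive s 1 (g p) (d p s)) ->
  (forall p, continuous (f p)) -> (forall p, continuous (d p)) ->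
  (forall p s, 0 <= p <= 1 -> 0 <= s -> [/\ `|f p s| <= C * expR (- s),
    `|g p s| <= C * expR (- s) & `|d p s| <= C * expR (- s)]) ->
  (forall p, g p 0 = 0) ->
  \int[mu]_(s in halfline) f 0 s = \int[mu]_(s in halfline) f 1 s.
Proof.
move=> C0 df dg cf cd bnd g0.
pose q (t : R) := sin t ^+ 2.
have q01 t : 0 <= q t <= 1.
  by rewrite sqr_ge0 -(cos2Dsin2 t) lerDr sqr_ge0.
have dq (t : R) : is_derive t 1 q (2 * sin t * cos t).
  have := is_deriveX 2 (is_derive_sin t).
  by rewrite /GRing.scale /= expr1.
pose h t s := f (q t) s.
have dh (t s : R) : is_derive t 1 (h ^~ s) (d (q t) s * (2 * sin t * cos t)).
  exact: (@is_derive1_comp _ (f ^~ s) q).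
have ih t : mu.-integrable halfline (EFin \o h t).
  apply: (integrable_dominated C0) => [|s s0]; first exact: cf.
  by have [] := bnd _ _ (q01 t) s0.
have C20 : 0 <= 2 * C by lra.
pose F t := \int[mu]_(s in halfline) h t s.
have dF (t : R) : is_derive t 1 F 0.
  have It : `]t - 1, t + 1[%classic t by rewrite /= in_itv /=; apply/andP; split; lra.
  have dh' (x s : R) : derivable (h ^~ s) x 1 by have [] := dh x s.
  have hd x s : partial1of2 h x s = d (q x) s * (2 * sin x * cos x).
    by rewrite partial1of2E; have [] := dh x s.
  have G0 (s : R) : 0 <= 2 * C * expR (- s) by rewrite mulr_ge0 ?expR_ge0.
  have Gb (x s : R) : `]t - 1, t + 1[%classic x -> halfline s ->
      `|partial1of2 h x s| <= 2 * C * expR (- s).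
    move=> _; rewrite /= in_itv /= andbT => s0; rewrite hd normrM.
    have [_ _ b] := bnd _ _ (q01 x) s0.
    rewrite [leRHS](_ : _ = (C * expR (- s)) * (2 * 1 * 1)); last by ring.
    rewrite ler_pM// !normrM ger0_norm// !mulr1.
    by rewrite -[leRHS]mulr1 ler_pM ?mulr_ge0 ?cos_max// ler_piMr ?sin_max.
  have mH : measurable (halfline : set R) by [].
  have dd := @derivable_under_integral _ _ _ mu h halfline mH t _ _ It
    (fun x _ => ih x) (fun x s _ _ => dh' x s) _ G0 (integrable_expRN C20) Gb.
  have ed := @differentiation_under_integral _ _ _ mu h halfline mH t _ _ It
    (fun x _ => ih x) (fun x s _ _ => dh' x s) _ G0 (integrable_expRN C20) Gb.
  apply: DeriveDef => //; rewrite -derive1E ed.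
  under eq_Rintegral do rewrite hd.
  rewrite RintegralZr//; last first.
    apply: (integrable_dominated C0); first exact: cd.
    by move=> s s0; have [] := bnd _ _ (q01 t) s0.
  rewrite (@Rintegral_halfline_FTC C _ (g (q t))) ?g0 ?oppr0 ?mul0r//.
  - by move=> s s0; have [] := bnd _ _ (q01 t) s0.
  - by move=> s s0; have [] := bnd _ _ (q01 t) s0.
have := is_derive_0_is_cst 0 (pi / 2) dF.
by rewrite /F /h /q sin0 sin_pihalf expr0n expr1n.
Qed.

Lemma Rintegral_opp (D : set R) (f : R -> R) :
  \int[mu]_(t in D) (- f t) = - \int[mu]_(t in D) f t.
Proof.
rewrite /Rintegral integralE [in RHS]integralE.
have -> : (fun t => (- f t)%:E) = (\- (EFin \o f))%E by [].
rewrite funeposN funenegN.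
by case: (integral _ _ _) => [a| |]; case: (integral _ _ _) => [b| |] //=;
  rewrite ?oppr0 ?opprB ?oppr0.
Qed.

(** Reduces changes of variables to nonnegative integrands. *)
Lemma Rintegral_posneg (D : set R) (f : R -> R) :
  \int[mu]_(t in D) f t = fine (\int[mu]_(t in D) (Num.max (f t) 0)%:E -
                               \int[mu]_(t in D) (Num.max (- f t) 0)%:E)%E.
Proof.
rewrite /Rintegral -[X in fine (integral _ _ X)]/(EFin \o f) integralE.
congr fine; congr (_ - _)%E; apply: eq_integral => t _.
  by rewrite funeposE /= EFin_max.
by rewrite funenegE /= EFin_max.
Qed.

Let fine_mul2B (a b : \bar R) : (0 <= a)%E -> (0 <= b)%E ->
  fine (2%:E * a - 2%:E * b)%E = 2 * fine (a - b)%E.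
Proof.
have e : (2%:E * +oo = +oo :> \bar R)%E by rewrite mulry gtr0_sg ?mul1e.
case: a => [a| |] // _; case: b => [b| |] // _; rewrite ?e.
- by rewrite -!EFinM -!EFinB /= mulrBr.
- by rewrite /= mulr0.
- by rewrite /= mulr0.
- by rewrite /= mulr0.
Qed.

Lemma Rintegral_even (f : R -> R) : continuous f -> (forall t, f (- t) = f t) ->
  \int[mu]_t f t = 2 * \int[mu]_(t in halfline) f t.
Proof.
move=> cf ef.
have half (h : R -> R) : continuous h -> (forall t, h (- t) = h t) ->
    (forall t, 0 <= h t) ->
    (\int[mu]_t (h t)%:E = 2%:E * \int[mu]_(t in halfline) (h t)%:E)%E.
  move=> ch eh h0; rewrite ge0_symfun_integralT//; first by rewrite set_itvcy.
  by move=> t; rewrite /= eh.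
pose fp t := Num.max (f t) 0; pose fn t := Num.max (- f t) 0.
have cfp : continuous fp.
  by move=> t; apply: continuous_max; [exact: cf|exact: cvg_cst].
have cfn : continuous fn.
  move=> t; apply: (@continuous_max _ _ (fun t => - f t)); last exact: cvg_cst.
  by apply: continuousN; exact: cf.
rewrite !Rintegral_posneg (half fp cfp) ?(half fn cfn)//; last 4 first.
- by move=> t; rewrite /fn ef.
- by move=> t; rewrite le_max lexx orbT.
- by move=> t; rewrite /fp ef.
- by move=> t; rewrite le_max lexx orbT.
have pos h : (forall t, 0 <= h t) -> (0 <= \int[mu]_(t in halfline) (h t)%:E)%E.
  by move=> h0; apply: integral_ge0 => t _; rewrite lee_fin.
have /pos : forall t, 0 <= fp t by move=> t; rewrite le_max lexx orbT.
have /pos : forall t, 0 <= fn t by move=> t; rewrite le_max lexx orbT.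
by move=> b0 a0; exact: fine_mul2B.
Qed.

Lemma Rintegral_shift (f : R -> R) (b : R) : continuous f ->
  \int[mu]_(s in halfline) f s =
  \int[mu]_(tau in `[- b, +oo[%classic) f (tau + b).
Proof.
move=> cf; pose F (tau : R) := tau + b.
have dF (t : R) : is_derive t 1 F 1.
  by rewrite -[X in is_derive _ _ _ X]addr0; exact: is_deriveD.
have F'E : derive1 F = cst 1.
  by apply/funext => t; rewrite derive1E; have [] := dF t.
have cF : continuous F.
  by move=> t; apply/differentiable_continuous/derivable1_diffP; have [] := dF t.
have shift (h : R -> R) : continuous h -> (forall t, 0 <= h t) ->
    (\int[mu]_(s in halfline) (h s)%:E =
     \int[mu]_(tau in `[(- b)%R, +oo[%classic) (h (tau + b)%R)%:E)%E.
  move=> ch h0.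
  transitivity (\int[mu]_(s in `[F (- b)%R, +oo[%classic) (h s)%:E)%E.
    by rewrite /F addNr.
  rewrite (@increasing_ge0_integration_by_substitutiony _ F h (- b)).
  - by apply: eq_integral => t _; rewrite F'E /= mulr1.
  - by move=> s t _ _; rewrite /F ltrD2r.
  - by move=> t _; rewrite F'E; exact: cst_continuous.
  - by rewrite F'E; exact: is_cvg_cst.
  - by rewrite F'E; exact: is_cvg_cst.
  - split; first by move=> t _; have [] := dF t.
    exact/cvg_at_right_filter/cF.
  - apply/cvgryPge => A; near=> x; rewrite /F -lerBlDr; near: x.
    by apply: nbhs_pinfty_ge; exact: num_real.
  - exact: continuous_subspaceT.
  - by move=> t _.
pose fp t := Num.max (f t) 0; pose fn t := Num.max (- f t) 0.
have cfp : continuous fp.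
  by move=> t; apply: continuous_max; [exact: cf|exact: cvg_cst].
have cfn : continuous fn.
  move=> t; apply: (@continuous_max _ _ (fun t => - f t)); last exact: cvg_cst.
  by apply: continuousN; exact: cf.
rewrite !Rintegral_posneg (shift fp cfp) ?(shift fn cfn)// => t;
  by rewrite /fp /fn le_max lexx orbT.
Unshelve. all: by end_near. Qed.

(** A dominating function for integrals over the whole line, for which the decay
    rate is imposed by the saddle point. *)
Lemma integrable_expRN_norm (K m : R) : 0 <= K -> 0 < m ->
  mu.-integrable setT (EFin \o (fun tau => K * expR (- (m * `|tau|)))).
Proof.
move=> K0 m0; pose g (t : R) := K * expR (- (m * `|t|)).
have cg : continuous g.
  move=> t; apply: cvgM; first exact: cvg_cst.
  apply: (@continuous_comp _ _ _ (fun t : R => - (m * `|t|)) expR).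
    apply: continuousN; apply: cvgM; first exact: cvg_cst.
    exact: norm_continuous.
  exact: continuous_expR.
have g0 t : 0 <= g t by rewrite mulr_ge0 ?expR_ge0.
apply/integrableP; split; first by apply/measurable_EFinP; exact: continuous_measurable_in.
apply: (@le_lt_trans _ _ (\int[mu]_t (g t)%:E)%E).
  rewrite le_eqVlt; apply/orP; left; apply/eqP/eq_integral => s _ /=.
  by congr EFin; exact: (ger0_norm (g0 s)).
rewrite ge0_symfun_integralT//; last by move=> t; rewrite /g /= normrN.
have dF (t : R) : is_derive t 1 (fun t => - (K / m) * expR (- (m * t)))
    (K * expR (- (m * t))).
  have e1 : is_derive t 1 (fun t : R => - (m * t)) (- m).
    have := is_deriveZ (- m) (is_derive_id t 1).
    have -> : (- m) \*: id = (fun t : R => - (m * t)).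
      by apply/funext => s; rewrite -mulNr.
    by move=> h; apply: is_derive_eq h _; exact: mulr1.
  have e2 : is_derive t 1 (expR \o (fun t : R => - (m * t)))
    (expR (- (m * t)) * - m) by exact: is_derive1_comp.
  have := is_deriveZ (- (K / m)) e2; rewrite /GRing.scale /=.
  move=> h; apply: is_derive_eq h _; rewrite mulrCA -mulrN mulrNN.
  by rewrite divfK ?gt_eqF// mulrC.
have cF : continuous (fun t : R => - (K / m) * expR (- (m * t))).
  by move=> t; apply/differentiable_continuous/derivable1_diffP; have [] := dF t.
have -> : (\int[mu]_(x in [set x | 0 <= x]%R) (g x)%:E =
    \int[mu]_(x in halfline) (K * expR (- (m * x)))%:E)%E.
  rewrite set_itvcy; apply: eq_integral => t; rewrite inE /= => t0.
  by rewrite /g ger0_norm.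
rewrite (@ge0_continuous_FTC2y _ _ (fun t => - (K / m) * expR (- (m * t))) 0 0).
- by rewrite -EFinB -EFinM ltry.
- by move=> t _; rewrite mulr_ge0 ?expR_ge0.
- apply: continuous_subspaceT => t; apply: cvgM; first exact: cvg_cst.
  apply: (@continuous_comp _ _ _ (fun t : R => - (m * t)) expR).
    by apply: continuousN; apply: cvgM; [exact: cvg_cst|exact: cvg_id].
  exact: continuous_expR.
- rewrite -[X in _ --> X](mulr0 (- (K / m))).
  apply: cvgM; first exact: cvg_cst.
  have mt : m * t @[t --> +oo] --> +oo by apply: gt0_cvgMry => //; exact: cvg_id.
  exact: (cvg_comp _ _ mt (@cvgr_expR R)).
- by move=> t _; have [] := dF t.
- exact/cvg_at_right_filter/cF.
- by move=> t _; rewrite derive1E; have [] := dF t.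
Qed.

End real_integrals.

(** * Hermite polynomials as integrals along a ray *)

Section ray_representation.
Context {R : realType}.
Local Open Scope complex_scope.
Local Notation mu := (@lebesgue_measure R).
Local Notation halfline := `[0%R, +oo[%classic.

(** The bound [expR (- s)] is used as a common dominating function on the
    half-line: any Gaussian beats any exponential growth. *)
Lemma expgrowth_absorb (K m : R) : 0 <= K -> 0 < m ->
  exists2 C, 0 <= C & forall s, 0 <= s ->
    K * expR (K * s) * expR (K * s + K - m * s ^+ 2) <= C * expR (- s).
Proof.
move=> K0 m0; pose b := 2 * K + 1.
exists (K * expR (K + b ^+ 2 / (4 * m))); first by rewrite mulr_ge0 ?expR_ge0.
move=> s s0; rewrite -!mulrA -!expRD ler_wpM2l// ler_expR.
have : 0 <= (b - 2 * m * s) ^+ 2 / (4 * m).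
  by rewrite mulr_ge0 ?sqr_ge0// invr_ge0; lra.
have -> : (b - 2 * m * s) ^+ 2 / (4 * m) =
    b ^+ 2 / (4 * m) - b * s + m * s ^+ 2 by field; rewrite gt_eqF.
rewrite /b; nra.
Qed.

(** The factors that multiply the Gaussian in the integrands below, uniformly in
    the deformation parameter [p]. *)
Definition expgrowth (phi : R -> R -> R[i]) : Prop :=
  exists2 K, 0 <= K & forall p s, 0 <= p <= 1 -> 0 <= s ->
    normc (phi p s) <= K * expR (K * s).

Lemma expgrowth_cst z : expgrowth (fun _ _ => z).
Proof.
exists (normc z) => [|p s _ s0]; first exact: normc_ge0.
rewrite ler_peMr ?normc_ge0// -[leLHS]expR0 ler_expR mulr_ge0 ?normc_ge0//.
Qed.

Lemma expgrowth_param : expgrowth (fun p _ => p%:C).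
Proof.
exists 1 => // p s /andP[p0 p1] s0; rewrite normc_real ger0_norm// mul1r.
by rewrite (le_trans p1)// -[leLHS]expR0 ler_expR mulr_ge0.
Qed.

Lemma expgrowth_var : expgrowth (fun _ s => s%:C).
Proof.
exists 1 => // p s _ s0; rewrite normc_real ger0_norm// !mul1r.
by have := expR_ge1Dx s; lra.
Qed.

Lemma expgrowthD phi psi : expgrowth phi -> expgrowth psi ->
  expgrowth (fun p s => phi p s + psi p s).
Proof.
move=> [K K0 hK] [L L0 hL]; exists (K + L) => [|p s p01 s0]; first by lra.
rewrite (le_trans (le_normcD _ _))// mulrDl lerD//.
  by rewrite (le_trans (hK _ _ p01 s0))// ler_wpM2l// ler_expR; nra.
by rewrite (le_trans (hL _ _ p01 s0))// ler_wpM2l// ler_expR; nra.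
Qed.

Lemma expgrowthM phi psi : expgrowth phi -> expgrowth psi ->
  expgrowth (fun p s => phi p s * psi p s).
Proof.
move=> [K K0 hK] [L L0 hL]; exists (K * L + K + L) => [|p s p01 s0]; first by nra.
rewrite normcM (le_trans (ler_pM _ _ (hK _ _ p01 s0) (hL _ _ p01 s0))) ?normc_ge0//.
rewrite mulrACA -expRD ler_pM ?mulr_ge0 ?expR_ge0 ?ler_expR//; first by lra.
by have := mulr_ge0 (mulr_ge0 K0 L0) s0; lra.
Qed.

Lemma expgrowthX phi n : expgrowth phi -> expgrowth (fun p s => phi p s ^+ n).
Proof.
move=> gphi; elim: n => [|n ih].
  by under eq_fun do under eq_fun do rewrite expr0; exact: expgrowth_cst.
under eq_fun do under eq_fun do rewrite exprS; exact: expgrowthM.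
Qed.

(** The integrand of [w ^+ n * exp ((w - x) ^+ 2 / 2) dw] along the ray
    leaving [c] in the direction [zeta]. *)
Definition hermite_ray n (x c : R) (zeta : R[i]) (s : R) : R[i] :=
  zeta * ((c%:C + s%:C * zeta) ^+ n * cexp ((c%:C + s%:C * zeta - x%:C) ^+ 2 / 2)).

(** Uniform decay along the rays joining the vertical direction to [zeta]: the cone
    [|Re zeta| < Im zeta] is convex and contains ['i], and on a segment of it the
    square of the direction has a real part bounded above by a negative number. *)
Lemma gauss_ray_bound (y : R) (zeta : R[i]) : `|Re zeta| < Im zeta ->
  exists K m, [/\ 0 <= K, 0 < m & forall p s, 0 <= p <= 1 -> 0 <= s ->
    normc (cexp (((p * y)%:C + s%:C * ('i + p%:C * (zeta - 'i))) ^+ 2 / 2)) <=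
    expR (K * s + K - m * s ^+ 2)].
Proof.
case: zeta => k l kl; rewrite /= in kl; pose m := Num.min 1 (l - `|k|).
have m0 : 0 < m by rewrite lt_min ltr01 subr_gt0.
exists (y ^+ 2 + `|y| * `|k|), (m ^+ 2 / 2); split.
- by rewrite addr_ge0 ?sqr_ge0// mulr_ge0.
- by rewrite divr_gt0 ?exprn_gt0.
move=> p s /andP[p0 p1] s0; rewrite normc_cexp ler_expR.
have -> : Re (((p * y)%:C + s%:C * ('i + p%:C * (k +i* l - 'i))) ^+ 2 / 2) =
    ((p * y + p * k * s) ^+ 2 - (1 - p + p * l) ^+ 2 * s ^+ 2) / 2.
  rewrite invC2.
  rewrite expr2; simpc => /=; ring.
have m1 : m <= 1 by rewrite ge_min lexx.
have m2 : m <= l - `|k| by rewrite ge_min lexx orbT.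
have h1 : p * `|k| + m <= 1 - p + p * l by nra.
have pp : p * p <= 1 by nra.
have k0 : 0 <= `|k| := normr_ge0 k.
have h2 : m ^+ 2 + p ^+ 2 * k ^+ 2 <= (1 - p + p * l) ^+ 2.
  have -> : k ^+ 2 = `|k| ^+ 2 by rewrite real_normK ?num_real.
  have : (p * `|k| + m) ^+ 2 <= (1 - p + p * l) ^+ 2.
    by rewrite ler_sqr ?nnegrE; nra.
  have : 0 <= p * `|k| * m by rewrite !mulr_ge0// ltW.
  nra.
have h3 : p * p * (y * k * s) <= `|y| * `|k| * s.
  rewrite (le_trans (ler_norm _))// !normrM (ger0_norm p0) (ger0_norm s0).
  have : 0 <= `|y| * `|k| * s by rewrite !mulr_ge0 ?normr_ge0.
  by move=> T0; rewrite ler_piMl.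
have h4 : p * p * y ^+ 2 <= y ^+ 2 by rewrite ler_piMl ?sqr_ge0.
have h5 : (m ^+ 2 + p ^+ 2 * k ^+ 2) * s ^+ 2 <= (1 - p + p * l) ^+ 2 * s ^+ 2.
  by rewrite ler_wpM2r ?sqr_ge0.
have h6 : 0 <= `|y| * `|k| by rewrite mulr_ge0.
have h7 := sqr_ge0 y.
have h8 : 0 <= y ^+ 2 * s by rewrite mulr_ge0.
lra.
Qed.

Lemma expgrowth_gauss_ray (y : R) (zeta : R[i]) phi : `|Re zeta| < Im zeta ->
  expgrowth phi -> exists2 C, 0 <= C & forall p s, 0 <= p <= 1 -> 0 <= s ->
    normc (phi p s *
      cexp (((p * y)%:C + s%:C * ('i + p%:C * (zeta - 'i))) ^+ 2 / 2)) <=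
    C * expR (- s).
Proof.
move=> hz [K2 K20 hphi]; have [K1 [m [K10 m0 gb]]] := gauss_ray_bound y hz.
pose K := K1 + K2; have K0 : 0 <= K by rewrite /K; lra.
have [C C0 hC] := expgrowth_absorb K0 m0.
exists C => // p s p01 s0; rewrite (le_trans _ (hC s s0))// normcM.
rewrite ler_pM ?normc_ge0//.
  by rewrite (le_trans (hphi _ _ p01 s0))// ler_pM ?expR_ge0// ?ler_expR
    ?ler_wpM2r// /K; lra.
rewrite (le_trans (gb _ _ p01 s0))// ler_expR /K.
by have := mulr_ge0 K20 s0; lra.
Qed.

Lemma hermite_ray_dominated n (x c : R) (zeta : R[i]) : `|Re zeta| < Im zeta ->
  exists2 C, 0 <= C & forall s, 0 <= s ->
    normc (hermite_ray n x c zeta s) <= C * expR (- s).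
Proof.
move=> hz.
have gp : expgrowth (fun _ s => zeta * (c%:C + s%:C * zeta) ^+ n).
  apply: expgrowthM; [exact: expgrowth_cst|apply: expgrowthX].
  apply: expgrowthD; [exact: expgrowth_cst|apply: expgrowthM].
    exact: expgrowth_var.
  exact: expgrowth_cst.
have [C C0 hC] := expgrowth_gauss_ray (c - x) hz gp.
exists C => // s s0; have := hC 1 s; rewrite lexx ler01 => /(_ isT s0).
rewrite /hermite_ray mulrA mul1r; congr (normc (_ * cexp (_ ^+ 2 / 2)) <= _).
by rewrite !rmorph1 mul1r [_ + (_ - _)]addrC subrK rmorphB addrAC.
Qed.

Lemma is_cderive_horner n (x : R) (f : R -> R[i]) (t : R) (d : R[i]) :
  is_cderive f t d ->
  is_cderive (fun t => f t ^+ n * cexp ((f t - x%:C) ^+ 2 / 2)) t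
    (d * ((n%:R * f t ^+ n.-1 + f t ^+ n * (f t - x%:C)) *
          cexp ((f t - x%:C) ^+ 2 / 2))).
Proof.
move=> df.
have e1 := is_cderiveX 2 (is_cderiveD df (is_cderive_cst (- x%:C) t)).
have e2 := is_cderive_cexp (is_cderiveM e1 (is_cderive_cst 2^-1 t)).
apply: is_cderive_eq; first exact: (is_cderiveM (is_cderiveX n df) e2).
by rewrite /=; field; rewrite ?pnatr_eq0.
Qed.

Lemma ccontinuous_hermite_ray n (x c : R) zeta :
  ccontinuous (hermite_ray n x c zeta).
Proof.
have cw : ccontinuous (fun s : R => c%:C + s%:C * zeta).
  apply: ccontinuousD; first exact: ccontinuous_cst.
  apply: ccontinuousM; last exact: ccontinuous_cst.
  by apply: ccontinuous_real => s; exact: cvg_id.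
apply: ccontinuousM; first exact: ccontinuous_cst.
apply: ccontinuousM; first exact: ccontinuousX.
apply: ccontinuous_cexp; apply: ccontinuousM; last exact: ccontinuous_cst.
by apply: ccontinuousX; apply: ccontinuousD => //; exact: ccontinuous_cst.
Qed.

(** A coordinate [L] of the contour integral does not change when the ray is
    deformed: the derivative of the integrand in the deformation parameter is an
    exact derivative along the ray, whose primitive vanishes at infinity and has
    no [L]-coordinate at the vertex. For [L = Im] the vertex may move along the
    real axis; for [L = Re] it has to stay fixed. *)
Lemma hermite_ray_invariant n (x c : R) (zeta : R[i]) (L : R[i] -> R) :
  L = Re \/ L = Im -> (forall r : R, L ((c - x) * r)%:C = 0) ->
  `|Re zeta| < Im zeta ->
  \int[mu]_(s in halfline) L (hermite_ray n x x 'i s) =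
  \int[mu]_(s in halfline) L (hermite_ray n x c zeta s).
Proof.
move=> LE Lc hz.
have dL f t d : is_cderive f t d -> is_derive t 1 (L \o f) (L d).
  by case: LE => -> [].
have cL f : ccontinuous f -> continuous (L \o f) by case: LE => -> [].
have bL z : `|L z| <= normc z.
  by case: LE => ->; [exact: Re_le_normc|exact: Im_le_normc].
(* The ray with vertex c_ p and direction z_ p; dw is the velocity of its points
   in p, d the mixed derivative, and g the primitive of d along the ray. *)
pose z_ (p : R) : R[i] := 'i + p%:C * (zeta - 'i).
pose c_ (p : R) : R := x + p * (c - x).
pose w (p s : R) := (c_ p)%:C + s%:C * z_ p.
pose dw (s : R) := (c - x)%:C + s%:C * (zeta - 'i).
pose E p s := cexp ((w p s - x%:C) ^+ 2 / 2).
pose g p s := dw s * (w p s ^+ n * E p s).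
pose d p s := (zeta - 'i) * (w p s ^+ n * E p s) +
  z_ p * dw s * ((n%:R * w p s ^+ n.-1 + w p s ^+ n * (w p s - x%:C)) * E p s).
have dzp (p : R) : is_cderive z_ p (zeta - 'i) by exact: is_cderive_affine.
have dwp (p s : R) : is_cderive (w ^~ s) p (dw s).
  have := is_cderiveD (is_cderive_affine x%:C (c - x)%:C p)
    (is_cderiveM (is_cderive_cst s%:C p) (dzp p)).
  have -> : (fun t : R => x%:C + t%:C * (c - x)%:C + s%:C * z_ t) = w ^~ s.
    by apply/funext => t; rewrite /w /c_ [in RHS]rmorphD [in RHS]rmorphM.
  by move/is_cderive_eq; apply; rewrite mul0r add0r.
have dws (p s : R) : is_cderive (w p) s (z_ p) by exact: is_cderive_affine.
have ddw (s : R) : is_cderive dw s (zeta - 'i) by exact: is_cderive_affine.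
have df (p s : R) : is_cderive (fun p => hermite_ray n x (c_ p) (z_ p) s) p (d p s).
  apply: is_cderive_eq.
    exact: (is_cderiveM (dzp p) (is_cderive_horner n x (dwp p s))).
  by rewrite /d /E; ring.
have dg (p s : R) : is_cderive (g p) s (d p s).
  apply: is_cderive_eq.
    exact: (is_cderiveM (ddw s) (is_cderive_horner n x (dws p s))).
  by rewrite /d /E; ring.
have cs : ccontinuous (fun s : R => s%:C).
  by apply: ccontinuous_real => s; exact: cvg_id.
have cw p : ccontinuous (w p).
  apply: ccontinuousD; first exact: ccontinuous_cst.
  by apply: ccontinuousM => //; exact: ccontinuous_cst.
have cdw : ccontinuous dw.
  apply: ccontinuousD; first exact: ccontinuous_cst.
  by apply: ccontinuousM => //; exact: ccontinuous_cst.
have cwx p : ccontinuous (fun s => w p s - x%:C).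
  by apply: ccontinuousD => //; exact: ccontinuous_cst.
have cE p : ccontinuous (E p).
  apply: ccontinuous_cexp; apply: ccontinuousM; last exact: ccontinuous_cst.
  exact: ccontinuousX.
have cwn p k : ccontinuous (fun s => w p s ^+ k) by exact: ccontinuousX.
have cd p : ccontinuous (d p).
  apply: ccontinuousD.
    by apply: ccontinuousM; [exact: ccontinuous_cst|exact: ccontinuousM].
  apply: ccontinuousM.
    by apply: ccontinuousM => //; exact: ccontinuous_cst.
  apply: ccontinuousM => //; apply: ccontinuousD; last exact: ccontinuousM.
  by apply: ccontinuousM => //; exact: ccontinuous_cst.
have gz : expgrowth (fun p _ => z_ p).
  apply: expgrowthD; first exact: expgrowth_cst.
  by apply: expgrowthM; [exact: expgrowth_param|exact: expgrowth_cst].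
have gw : expgrowth w.
  have -> : w = fun p s => x%:C + p%:C * (c - x)%:C + s%:C * z_ p.
    apply/funext => p; apply/funext => s.
    by rewrite /w /c_ [in LHS]rmorphD [in LHS]rmorphM.
  apply: expgrowthD; last by apply: expgrowthM => //; exact: expgrowth_var.
  apply: expgrowthD; first exact: expgrowth_cst.
  by apply: expgrowthM; [exact: expgrowth_param|exact: expgrowth_cst].
have gdw : expgrowth (fun _ => dw).
  apply: expgrowthD; first exact: expgrowth_cst.
  by apply: expgrowthM; [exact: expgrowth_var|exact: expgrowth_cst].
have gwn k : expgrowth (fun p s => w p s ^+ k) by exact: expgrowthX.
have absorb phi : expgrowth phi -> exists2 C, 0 <= C & forall p s,
    0 <= p <= 1 -> 0 <= s -> normc (phi p s * E p s) <= C * expR (- s).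
  move=> /(expgrowth_gauss_ray (c - x) hz)[C C0 hC]; exists C => // p s p01 s0.
  have := hC _ _ p01 s0; congr (normc (_ * cexp (_ ^+ 2 / 2)) <= _).
  by rewrite /w /c_ rmorphD addrAC [x%:C + _]addrC addrK.
have [Cf Cf0 bf] := absorb _ (expgrowthM gz (gwn n)).
have [Cg Cg0 bg] := absorb _ (expgrowthM gdw (gwn n)).
have [Cd Cd0 bd] : exists2 C, 0 <= C & forall p s,
    0 <= p <= 1 -> 0 <= s -> normc (d p s) <= C * expR (- s).
  pose phi p s := (zeta - 'i) * w p s ^+ n + z_ p * dw s *
    (n%:R * w p s ^+ n.-1 + w p s ^+ n * (w p s + (- x%:C))).
  have [|C C0 hC] := absorb phi.
    apply: expgrowthD; first by apply: expgrowthM => //; exact: expgrowth_cst.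
    apply: expgrowthM; first exact: expgrowthM.
    apply: expgrowthD; first by apply: expgrowthM => //; exact: expgrowth_cst.
    by apply: expgrowthM => //; apply: expgrowthD => //; exact: expgrowth_cst.
  exists C => // p s p01 s0; rewrite (le_trans _ (hC p s p01 s0))//.
  by rewrite /d /phi le_eqVlt; apply/orP; left; apply/eqP; congr normc; ring.
have c0 : c_ 0 = x by rewrite /c_ mul0r addr0.
have c1 : c_ 1 = c by rewrite /c_ mul1r addrC subrK.
have z0 : z_ 0 = 'i by rewrite /z_ mul0r addr0.
have z1 : z_ 1 = zeta by rewrite /z_ mul1r addrC subrK.
transitivity (\int[mu]_(s in halfline) L (hermite_ray n x (c_ 0) (z_ 0) s)).
  by rewrite c0 z0.
transitivity (\int[mu]_(s in halfline) L (hermite_ray n x (c_ 1) (z_ 1) s));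
  last by rewrite c1 z1.
apply: (@homotopy_Rintegral R (Cf + Cg + Cd)
  (fun p s => L (hermite_ray n x (c_ p) (z_ p) s))
  (fun p s => L (g p s)) (fun p s => L (d p s))).
- by rewrite !addr_ge0.
- by move=> p s; exact: (dL _ _ _ (df p s)).
- by move=> p s; exact: (dL _ _ _ (dg p s)).
- by move=> p; exact: (cL _ (ccontinuous_hermite_ray _ _ _ _)).
- by move=> p; exact: (cL _ (cd p)).
- move=> p s p01 s0; split; apply: (le_trans (bL _)).
  + have := bf _ _ p01 s0; rewrite -mulrA => /le_trans; apply.
    by rewrite ler_wpM2r ?expR_ge0//; lra.
  + have := bg _ _ p01 s0; rewrite -mulrA => /le_trans; apply.
    by rewrite ler_wpM2r ?expR_ge0//; lra.
  + have := bd _ _ p01 s0; move=> /le_trans; apply.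
    by rewrite ler_wpM2r ?expR_ge0//; lra.
- move=> p; rewrite -[RHS](Lc (c_ p ^+ n * expR ((c_ p - x) ^+ 2 / 2))).
  congr L; rewrite /g /E /w /dw !(rmorph0 (real_complex R)) !mul0r !addr0.
  have e2 := @invC2 R.
  by rewrite -rmorphB e2 -!rmorphXn -(rmorphM (real_complex R)) cexpR -!rmorphM.
Qed.

(** The integrand takes conjugate values at conjugate points, so the integral over
    the vertical line through [x] is twice that of the real part over its upper
    half, which is the ray in the direction ['i]. *)
Theorem He_hermite_ray n (x c : R) (zeta : R[i]) : `|Re zeta| < Im zeta ->
  He n x = Num.sqrt (2 / pi) *
           \int[mu]_(s in halfline) Im (hermite_ray n x c zeta s).
Proof.
move=> hz; rewrite -(@hermite_ray_invariant _ _ _ _ Im) //; last by right.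
have e2 := @invC2 R.
have eI s : Im (hermite_ray n x x 'i s) =
    Re ((x +i* s) ^+ n) * expR (- (s ^+ 2 / 2)).
  rewrite /hermite_ray.
  have -> : x%:C + s%:C * 'i = x +i* s by simpc.
  have -> : (x +i* s - x%:C) ^+ 2 / 2 = (- (s ^+ 2 / 2))%:C.
    by rewrite e2 expr2; simpc; congr Complex; ring.
  rewrite cexpR mulrC ImiRe ReM /=; ring.
under [in RHS]eq_Rintegral do rewrite eI.
have cI : continuous (fun s => Im (hermite_ray n x x 'i s)).
  exact: (ccontinuous_hermite_ray n x x 'i).2.
have {cI} ce : continuous (fun s : R => Re ((x +i* s) ^+ n) * expR (- (s ^+ 2 / 2))).
  by under eq_fun do rewrite -eI.
have eR (z : R) : Re ((x +i* z) ^+ n * (normal_pdf 0 1 z)%:C) =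
    (Num.sqrt (2 * pi))^-1 * (Re ((x +i* z) ^+ n) * expR (- (z ^+ 2 / 2))).
  rewrite ReM /= mulr0 subr0 normal_pdfE ?oner_neq0// /normal_peak /normal_fun.
  rewrite subr0 expr1n mul1r -[pi *+ 2]mulr_natl mulNr.
  by rewrite mulrC -!mulrA [expR _ * _]mulrC.
rewrite /He /HeC /Cintegral /=.
under eq_Rintegral do rewrite eR.
rewrite Rintegral_even; last 2 first.
- by move=> s; apply: cvgM; [exact: cvg_cst|exact: ce].
- move=> t; rewrite sqrrN; congr (_ * (_ * _)).
  have -> : x +i* (- t) = conjc (x +i* t) by [].
  by rewrite -rmorphXn /=; case: (_ ^+ n).
rewrite RintegralZl//; last first.
  have hi : `|Re ('i : R[i])| < Im ('i : R[i]) by rewrite /= normr0.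
  have [C C0 hC] := hermite_ray_dominated n x x hi.
  apply: (integrable_dominated C0) => // s s0; rewrite -eI.
  exact: le_trans (Im_le_normc _) (hC s s0).
rewrite mulrA; congr (_ * _).
have p0 : 0 < pi :> R by exact: pi_gt0.
rewrite sqrtrM// sqrtrM// sqrtrV ?ltW// -{1}(sqr_sqrtr (ler0n R 2)).
have : 0 < Num.sqrt (pi : R) by rewrite sqrtr_gt0.
have : 0 < Num.sqrt (2 : R) by rewrite sqrtr_gt0.
move=> h1 h2; field; lra.
Qed.

End ray_representation.

(** * Limits of complex sequences and integrals *)

Section complex_limits.
Context {R : realType}.
Local Open Scope complex_scope.
Local Notation mu := (@lebesgue_measure R).
Local Notation halfline := `[0%R, +oo[%classic.

Definition ccvg (u : nat -> R[i]) (l : R[i]) : Prop :=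
  (Re (u n) @[n --> \oo] --> Re l) /\ (Im (u n) @[n --> \oo] --> Im l).

Lemma ccvg_cst z : ccvg (fun=> z) z.
Proof. by split; exact: cvg_cst. Qed.

Lemma ccvgM u v a b : ccvg u a -> ccvg v b -> ccvg (fun n => u n * v n) (a * b).
Proof.
move=> [u1 u2] [v1 v2]; split; rewrite ?ReM ?ImM.
- under eq_fun do rewrite ReM.
  by apply: cvgB; exact: cvgM.
- under eq_fun do rewrite ImM.
  by apply: cvgD; exact: cvgM.
Qed.

(** Turns an estimate of the modulus into convergence of both coordinates. *)
Lemma ccvg_normc (u : nat -> R[i]) l (e : nat -> R) :
  (\forall n \near \oo, normc (u n - l) <= e n) -> e n @[n --> \oo] --> (0 : R) ->
  ccvg u l.
Proof.
move=> ue e0.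
have h (L : R[i] -> R) : (forall z, `|L z| <= normc z) ->
    (forall z w, L (z - w) = L z - L w) -> L (u n) @[n --> \oo] --> L l.
  move=> bL LB; apply/subr_cvg0/norm_cvg0P.
  apply: (@squeeze_cvgr _ _ _ _ (fun=> 0) e) => //; last exact: cvg_cst.
  near=> n; rewrite normr_ge0 /= -LB (le_trans (bL _))//; near: n; exact: ue.
split; apply: h.
- exact: Re_le_normc. - by move=> [? ?] []. - exact: Im_le_normc. - by move=> [? ?] [].
Unshelve. all: by end_near. Qed.

Lemma ccvg_cexp u (l : R[i]) : ccvg u l -> ccvg (fun n => cexp (u n)) (cexp l).
Proof.
move=> [u1 u2]; apply: ccvgM.
  split => /=; last exact: cvg_cst.
  by apply: continuous_cvg u1; exact: continuous_expR.
split => /=.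
- by apply: continuous_cvg u2; exact: continuous_cos.
- by apply: continuous_cvg u2; exact: continuous_sin.
Qed.

Lemma ccvg_shiftS (u : nat -> R[i]) l : ccvg u l -> ccvg (fun n => u n.+1) l.
Proof.
move=> [u1 u2]; split.
- by rewrite -(cvg_shiftS (fun n => Re (u n))) in u1.
- by rewrite -(cvg_shiftS (fun n => Im (u n))) in u2.
Qed.

Lemma ccontinuous_measurable (D : set R) f : ccontinuous f ->
  measurable_fun D (Re \o f) /\ measurable_fun D (Im \o f).
Proof. by move=> [f1 f2]; split; exact: continuous_measurable_in. Qed.

Lemma dominated_Cintegral_cvg (D : set R) (f_ : nat -> R -> R[i]) (f : R -> R[i]) (g : R -> R) :
  measurable D ->
  (forall n, measurable_fun D (Re \o f_ n) /\ measurable_fun D (Im \o f_ n)) ->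
  (forall x, D x -> ccvg (f_ ^~ x) (f x)) ->
  mu.-integrable D (EFin \o g) ->
  (forall n x, D x -> normc (f_ n x) <= g x) ->
  ccvg (fun n => Cintegral D (f_ n)) (Cintegral D f).
Proof.
move=> mD mf ff ig fg; split => /=.
- apply: (@dominated_Rintegral_cvg _ D (fun n => Re \o f_ n) (Re \o f) g) => //.
  + by move=> n; have [] := mf n.
  + by move=> x /ff[].
  + by move=> n x Dx; exact: le_trans (Re_le_normc _) (fg n x Dx).
- apply: (@dominated_Rintegral_cvg _ D (fun n => Im \o f_ n) (Im \o f) g) => //.
  + by move=> n; have [] := mf n.
  + by move=> x /ff[].
  + by move=> n x Dx; exact: le_trans (Im_le_normc _) (fg n x Dx).
Qed.

Lemma CintegralZl (D : set R) (f : R -> R[i]) (z : R[i]) : measurable D ->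
  mu.-integrable D (EFin \o (Re \o f)) -> mu.-integrable D (EFin \o (Im \o f)) ->
  Cintegral D (fun s => z * f s) = z * Cintegral D f.
Proof.
move=> mD f1 f2; case: z => a b; rewrite /Cintegral.
have scaled c (h : R -> R) : mu.-integrable D (EFin \o h) ->
    mu.-integrable D (EFin \o (fun s => c * h s)).
  move=> ih; have := @integrableZl _ _ _ mu D mD c _ ih.
  by under [X in _ -> integrable _ _ X]eq_fun do rewrite /= EFinM.
rewrite [RHS]/GRing.mul /=; congr Complex.
- under eq_Rintegral do rewrite ReM /=.
  by rewrite RintegralB ?RintegralZl//; exact: scaled.
- under eq_Rintegral do rewrite ImM /=.
  by rewrite RintegralD ?RintegralZl//; exact: scaled.
Qed.

End complex_limits.

(** * Gaussian integrals along rays *)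

Section gaussian_rays.
Context {R : realType}.
Local Open Scope complex_scope.
Local Notation mu := (@lebesgue_measure R).
Local Notation halfline := `[0%R, +oo[%classic.

Lemma sqr_imaginary (s : R) : (s%:C * 'i) ^+ 2 / 2 = (- (s ^+ 2 / 2))%:C.
Proof.
rewrite invC2.
by rewrite expr2; simpc; congr Complex; ring.
Qed.

Lemma integral_half_gauss :
  \int[mu]_(s in halfline) expR (- (s ^+ 2 / 2)) = Num.sqrt (pi / 2).
Proof.
have cg : continuous (fun s : R => expR (- (s ^+ 2 / 2))).
  move=> s; apply: (@continuous_comp _ _ _ (fun s : R => - (s ^+ 2 / 2)) expR).
    apply: continuousN; apply: cvgM; last exact: cvg_cst.
    exact: exprn_continuous.
  exact: continuous_expR.
have := @integral_normal_pdf R 0 1.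
have e (z : R) : normal_pdf 0 1 z = (Num.sqrt (2 * pi))^-1 * expR (- (z ^+ 2 / 2)).
  rewrite normal_pdfE ?oner_neq0// /normal_peak /normal_fun.
  by rewrite subr0 expr1n mul1r -[pi *+ 2]mulr_natl mulNr.
under eq_integral do rewrite e.
move=> /(congr1 fine) /=.
rewrite -[X in X = _]/(\int[mu]_z ((Num.sqrt (2 * pi))^-1 * expR (- (z ^+ 2 / 2)))).
rewrite Rintegral_even; last 2 first.
- by move=> s; apply: cvgM; [exact: cvg_cst|exact: cg].
- by move=> t; rewrite sqrrN.
rewrite RintegralZl//; last first.
  have hi : `|Re ('i : R[i])| < Im ('i : R[i]) by rewrite /= normr0.
  have [C C0 hC] := hermite_ray_dominated 0 0 0 hi.
  apply: (integrable_dominated C0) => // s s0.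
  apply: le_trans (hC s s0); rewrite /hermite_ray expr0 mul1r normcM normc_cexp.
  rewrite ger0_norm ?expR_ge0// add0r subr0 sqr_imaginary.
  by rewrite /= expr0n expr1n add0r sqrtr1 mul1r.
move=> h; have p0 : 0 < pi :> R by exact: pi_gt0.
have s2 : 0 < Num.sqrt (2 : R) by rewrite sqrtr_gt0.
have sp : 0 < Num.sqrt (pi : R) by rewrite sqrtr_gt0.
have e2 : Num.sqrt (2 : R) ^+ 2 = 2 by rewrite sqr_sqrtr.
move: h; rewrite !sqrtrM ?ltW// sqrtrV//.
set I := Rintegral _ _ _; move=> h.
have -> : I = (2 * ((Num.sqrt 2 * Num.sqrt pi)^-1 * I)) * (Num.sqrt 2 * Num.sqrt pi / 2).
  by field; rewrite !gt_eqF.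
by rewrite h mul1r -{2}e2; field; rewrite gt_eqF.
Qed.

(** The case [n = 0] of the deformation: the ray is rotated onto the imaginary
    axis, where the integrand is a real Gaussian. The vertex is fixed, so both
    coordinates are preserved. *)
Lemma Cintegral_gauss_ray (zeta : R[i]) : `|Re zeta| < Im zeta ->
  zeta * Cintegral halfline (fun s => cexp ((s%:C * zeta) ^+ 2 / 2)) =
  (Num.sqrt (pi / 2)) *i.
Proof.
move=> hz; have [C C0 hC] := hermite_ray_dominated 0 0 0 hz.
have iz0 : 0 < Im zeta by rewrite (le_lt_trans _ hz).
have nz0 : 0 < normc zeta.
  by rewrite (lt_le_trans iz0)// (le_trans (ler_norm _))// Im_le_normc.
pose F s := cexp ((s%:C * zeta) ^+ 2 / 2).
have eF s : hermite_ray 0 0 0 zeta s = zeta * F s.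
  by rewrite /hermite_ray /F expr0 mul1r add0r subr0.
have cF : ccontinuous F.
  apply: ccontinuous_cexp; apply: ccontinuousM; last exact: ccontinuous_cst.
  apply: ccontinuousX; apply: ccontinuousM; last exact: ccontinuous_cst.
  by apply: ccontinuous_real => s; exact: cvg_id.
have bF s : 0 <= s -> normc (F s) <= C / normc zeta * expR (- s).
  move=> s0; have := hC s s0; rewrite eF normcM mulrAC ler_pdivlMr//.
  by rewrite mulrC.
have CZ0 : 0 <= C / normc zeta by rewrite divr_ge0// ltW.
rewrite -CintegralZl//; last 2 first.
- apply: (integrable_dominated CZ0) => [|s s0]; first exact: cF.1.
  exact: le_trans (Re_le_normc _) (bF s s0).
- apply: (integrable_dominated CZ0) => [|s s0]; first exact: cF.2.
  exact: le_trans (Im_le_normc _) (bF s s0).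
have inv (L : R[i] -> R) : L = Re \/ L = Im -> (L 0 = 0) ->
    \int[mu]_(s in halfline) L (zeta * F s) =
    \int[mu]_(s in halfline) L (hermite_ray 0 0 0 'i s).
  move=> LE L0; rewrite (@hermite_ray_invariant _ 0 0 0 zeta)//.
    by apply: eq_Rintegral => s _; rewrite eF.
  by move=> r; rewrite subrr mul0r.
have ei s : hermite_ray 0 0 0 'i s = (expR (- (s ^+ 2 / 2))) *i :> R[i].
  rewrite /hermite_ray expr0 mul1r add0r subr0.
  by rewrite sqr_imaginary cexpR; simpc.
rewrite /Cintegral !inv//; [|by right|by left].
congr Complex.
- under eq_Rintegral do rewrite ei /=.
  by rewrite Rintegral_cst//= mul0r.
- under eq_Rintegral do rewrite ei /=.
  exact: integral_half_gauss.
Qed.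

End gaussian_rays.

(** * Local analysis at a saddle point *)

Section saddle_points.
Context {R : realType}.
Local Open Scope complex_scope.

Lemma mean_value_bound (f df : R -> R) (K : R) :
  (forall t : R, is_derive t 1 f (df t)) ->
  (forall t, 0 <= t <= 1 -> `|df t| <= K) -> `|f 1 - f 0| <= K.
Proof.
move=> dfE dK.
have cf : {within `[0, 1], continuous f}.
  apply: continuous_subspaceT => t.
  by apply/differentiable_continuous/derivable1_diffP; have [] := dfE t.
have [c] := MVT ltr01 (fun x _ => dfE x) cf.
rewrite in_itv /= => /andP[c0 c1] ->; rewrite subr0 mulr1 dK//.
by rewrite !ltW.
Qed.

(** The product is [exp] of the remainder of [log (1 + v)] at order three. It is
    estimated along the segment from 0 to [v], where the first terms cancel in
    its derivative and leave the factor [v ^+ 4]. *)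
Lemma log_remainder_bound (v : R[i]) : normc v <= 1 ->
  normc ((1 + v) * cexp (- v + v ^+ 2 / 2 - v ^+ 3 / 3) - 1) <=
  2 * expR 3 * normc v ^+ 4.
Proof.
move=> v1.
pose e (t : R) : R[i] := - (t%:C * v) + (t%:C * v) ^+ 2 / 2 - (t%:C * v) ^+ 3 / 3.
pose phi (t : R) : R[i] := (1 + t%:C * v) * cexp (e t).
pose dphi (t : R) : R[i] := - (t%:C ^+ 3 * v ^+ 4) * cexp (e t).
have dv (t : R) : is_cderive (fun t : R => t%:C * v) t v.
  by have := is_cderive_affine 0 v t; under eq_fun do rewrite add0r.
have two0 : (2 : R[i]) != 0 by rewrite pnatr_eq0.
have three0 : (3 : R[i]) != 0 by rewrite pnatr_eq0.
have de (t : R) : is_cderive e t (- v + t%:C * v * v - (t%:C * v) ^+ 2 * v).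
  have e1 := is_cderiveM (is_cderive_cst (-1) t) (dv t).
  have e2 := is_cderiveM (is_cderiveX 2 (dv t)) (is_cderive_cst 2^-1 t).
  have e3 := is_cderiveM (is_cderiveX 3 (dv t)) (is_cderive_cst (- 3^-1) t).
  have := is_cderiveD (is_cderiveD e1 e2) e3.
  have -> : (fun t : R => -1 * (t%:C * v) + (t%:C * v) ^+ 2 / 2 +
      (t%:C * v) ^+ 3 * - 3^-1) = e by apply/funext => s; rewrite /e; ring.
  by move/is_cderive_eq; apply; rewrite /=; field; rewrite ?pnatr_eq0.
have dp (t : R) : is_cderive phi t (dphi t).
  have e1 := is_cderiveD (is_cderive_cst 1 t) (dv t).
  apply: is_cderive_eq; first exact: (is_cderiveM e1 (is_cderive_cexp (de t))).
  by rewrite /dphi; ring.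
have dK t : 0 <= t <= 1 -> normc (dphi t) <= expR 3 * normc v ^+ 4.
  move=> /andP[t0 t1].
  have tv : normc (t%:C * v) <= 1.
    by rewrite normcM normc_real ger0_norm// mulr_ile1// normc_ge0.
  rewrite /dphi normcM normcN normcM !normcX normc_real ger0_norm// normc_cexp.
  rewrite mulrC ler_pM ?expR_ge0 ?mulr_ge0 ?exprn_ge0 ?normc_ge0//; last first.
    by rewrite ler_piMl ?exprn_ge0 ?normc_ge0// exprn_ile1.
  rewrite ler_expR; apply: le_trans (ler_norm _) _.
  rewrite (le_trans (Re_le_normc _))//.
  have n2 : normc (2^-1 : R[i]) <= 1.
    by rewrite ComplexField.Normc.normcV normc_nat invf_le1//; lra.
  have n3 : normc (3^-1 : R[i]) <= 1.
    by rewrite ComplexField.Normc.normcV normc_nat invf_le1//; lra.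
  have b0 := normc_ge0 (t%:C * v).
  have h2 : normc ((t%:C * v) ^+ 2 / 2) <= 1.
    by rewrite normcM mulr_ile1 ?normc_ge0// normcX exprn_ile1.
  have h3 : normc ((t%:C * v) ^+ 3 / 3) <= 1.
    by rewrite normcM mulr_ile1 ?normc_ge0// normcX exprn_ile1.
  have := le_normcD (- (t%:C * v) + (t%:C * v) ^+ 2 / 2) (- ((t%:C * v) ^+ 3 / 3)).
  have := le_normcD (- (t%:C * v)) ((t%:C * v) ^+ 2 / 2).
  rewrite !normcN /e; lra.
have p0 : phi 0 = 1.
  rewrite /phi /e rmorph0 !mul0r !expr0n /= !mul0r oppr0 !addr0 cexp0 mulr1 //.
have p1 : phi 1 = (1 + v) * cexp (- v + v ^+ 2 / 2 - v ^+ 3 / 3).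
  by rewrite /phi /e rmorph1 mul1r.
rewrite -p1 -p0 (le_trans (normc_le_ReIm _))// -mulrA mulr2n mulrDl !mul1r lerD//.
- have -> : Re (phi 1 - phi 0) = Re (phi 1) - Re (phi 0) by case: (phi 1) (phi 0) => [? ?] [].
  apply: (@mean_value_bound (Re \o phi) (Re \o dphi)) => [t|t t01]; first by have [] := dp t.
  exact: le_trans (Re_le_normc _) (dK t t01).
- have -> : Im (phi 1 - phi 0) = Im (phi 1) - Im (phi 0) by case: (phi 1) (phi 0) => [? ?] [].
  apply: (@mean_value_bound (Im \o phi) (Im \o dphi)) => [t|t t01]; first by have [] := dp t.
  exact: le_trans (Im_le_normc _) (dK t t01).
Qed.

(** A factor at distance [d] from 1 can be raised to the power [n] as long as
    [n * d] is small. *)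
Lemma normc_expB1 (q : R[i]) n :
  normc (q ^+ n - 1) <= expR (n%:R * normc (q - 1)) - 1.
Proof.
set d := normc (q - 1); have d0 : 0 <= d := normc_ge0 _.
have qd : normc q <= expR d.
  have -> : q = 1 + (q - 1) by rewrite addrC subrK.
  rewrite (le_trans (le_normcD _ _))// ComplexField.Normc.normc1.
  exact: expR_ge1Dx.
elim: n => [|n ih].
  by rewrite expr0 subrr mul0r expR0 subrr ComplexField.Normc.normc0.
have -> : q ^+ n.+1 - 1 = q * (q ^+ n - 1) + (q - 1) by rewrite exprS; ring.
rewrite (le_trans (le_normcD _ _))// normcM -/d.
have -> : n.+1%:R * d = d + n%:R * d by rewrite -natr1; ring.
rewrite expRD (le_trans (lerD (ler_pM _ _ qd ih) (lexx d))) ?normc_ge0//.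
by have := expR_ge1Dx d; lra.
Qed.

Lemma ccvg_log_remainder (v : nat -> R[i]) :
  n%:R * normc (v n) ^+ 4 @[n --> \oo] --> (0 : R) ->
  ccvg (fun n => (1 + v n) ^+ n *
    cexp (n%:R * (- v n + v n ^+ 2 / 2 - v n ^+ 3 / 3))) 1.
Proof.
move=> nv.
pose e n := expR (2 * expR 3 * (n%:R * normc (v n) ^+ 4)) - 1.
apply: (@ccvg_normc _ _ _ e); last first.
  rewrite -(subrr 1) -{1}expR0 -(mulr0 (2 * expR 3)).
  apply: cvgB; last exact: cvg_cst.
  apply: continuous_cvg; first exact: continuous_expR.
  by apply: cvgM => //; exact: cvg_cst.
near=> n; have v1 : normc (v n) <= 1.
  have n1 : (1 : R) <= n%:R by rewrite ler1n; near: n; exact: nbhs_infty_gt.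
  have : n%:R * normc (v n) ^+ 4 < 1.
    by near: n; apply: (cvgr_lt _ nv); exact: ltr01.
  move=> h; rewrite leNgt; apply/negP => vn.
  have : 1 <= n%:R * normc (v n) ^+ 4.
    by rewrite mulr_ege1// exprn_ege1// ltW.
  lra.
rewrite -cexpX -exprMn (le_trans (normc_expB1 _ _))// /e lerB// ler_expR.
by rewrite [leRHS]mulrCA ler_wpM2l// log_remainder_bound.
Unshelve. all: by end_near. Qed.

(** Centring the integrand at the saddle point [w0]: the point [w = q * w0]
    corresponds to [v = 0], and [w0 + w0^-1] is the value of [x / q] for which
    the terms of first order in [v] cancel against those of [(1 + v) ^+ n]. *)
Lemma saddle_factor n (q w0 v r : R[i]) : q ^+ 2 = n%:R -> w0 != 0 ->
  (q * w0 * (1 + v)) ^+ n *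
    cexp ((q * w0 * (1 + v) - (q * (w0 + w0^-1) + r)) ^+ 2 / 2) =
  q ^+ n * w0 ^+ n * cexp (n%:R * (w0 ^- 2 / 2)) *
    cexp (r ^+ 2 / 2 - r * q * (w0 * v - w0^-1)) *
    ((1 + v) ^+ n * cexp (n%:R * (- v + w0 ^+ 2 * v ^+ 2 / 2))).
Proof.
move=> qn w00; have two0 : (2 : R[i]) != 0 by rewrite pnatr_eq0.
have -> : (q * w0 * (1 + v) - (q * (w0 + w0^-1) + r)) ^+ 2 / 2 =
    n%:R * (w0 ^- 2 / 2) + (r ^+ 2 / 2 - r * q * (w0 * v - w0^-1)) +
    n%:R * (- v + w0 ^+ 2 * v ^+ 2 / 2).
  by rewrite -qn; field; rewrite ?two0 ?w00 ?pnatr_eq0.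
by rewrite !cexpD !exprMn; ring.
Qed.

(** The expansion of [log (1 + v)] leaves the quadratic form
    [(w0 ^+ 2 - 1) / 2] of the saddle point, and a cubic term that matters only
    when this form degenerates, at [w0 = 1]. *)
Lemma ccvg_saddle (w0 e : R[i]) (v : nat -> R[i]) :
  n%:R * normc (v n) ^+ 4 @[n --> \oo] --> (0 : R) ->
  ccvg (fun n => n%:R * ((w0 ^+ 2 - 1) * v n ^+ 2 / 2 + v n ^+ 3 / 3)) e ->
  ccvg (fun n => (1 + v n) ^+ n *
    cexp (n%:R * (- v n + w0 ^+ 2 * v n ^+ 2 / 2))) (cexp e).
Proof.
move=> v4 ve; have := ccvgM (ccvg_log_remainder v4) (ccvg_cexp ve).
rewrite mul1r; congr ccvg; apply/funext => n.
rewrite -mulrA -cexpD; congr (_ * cexp _); field; rewrite ?pnatr_eq0//.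
Qed.

(** The modulus is estimated through the square of [normc z], which is a
    polynomial in the coordinates. *)
Lemma saddle_modulus (z u : R[i]) (y : R) n : normc z ^+ 2 <= expR y ->
  normc (z ^+ n * cexp (n%:R * u)) <= expR (n%:R * (y / 2 + Re u)).
Proof.
move=> zy; have zy2 : normc z <= expR (y / 2).
  rewrite -ler_sqr ?nnegrE ?expR_ge0 ?normc_ge0// -expRM_natl.
  by rewrite (le_trans zy)// ler_expR mulrCA divff ?mulr1// pnatr_eq0.
rewrite normcM normc_cexp normcX mulrDr expRD expRM_natl.
have -> : Re (n%:R * u) = n%:R * Re u.
  have -> : (n%:R : R[i]) = (n%:R : R)%:C by rewrite rmorph_nat.
  by rewrite ReM /= mul0r subr0.
by rewrite ler_wpM2r ?expR_ge0// lerXn2r ?nnegrE ?normc_ge0 ?expR_ge0.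
Qed.

Lemma cvg_invn : n%:R^-1 @[n --> \oo] --> (0 : R).
Proof. by rewrite -cvg_shiftS; exact: cvg_harmonic. Qed.

Lemma cvg_invsqrtn : (Num.sqrt n%:R)^-1 @[n --> \oo] --> (0 : R).
Proof.
under eq_fun do rewrite -sqrtrV ?ler0n//.
rewrite -(@sqrtr0 R); apply: continuous_cvg cvg_invn; exact: sqrt_continuous.
Qed.

Lemma powR_half_mul n : (n%:R : R) `^ (n%:R / 2) = Num.sqrt n%:R ^+ n.
Proof.
by rewrite mulrC powRrM -(@powR_mulrn R _ n) ?sqrtr_ge0// powR12_sqrt.
Qed.

(** The normalized integrand on the vertical line through the saddle point,
    in the variable [tau] for which it has a Gaussian limit. *)
Definition saddle_integrand n (w0 : R[i]) (tau : R) : R[i] :=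
  let v := tau *i / ((Num.sqrt n%:R)%:C * w0) in
  (1 + v) ^+ n * cexp (n%:R * (- v + w0 ^+ 2 * v ^+ 2 / 2)).

Lemma saddle_integrandE n (w0 : R[i]) tau : (0 < n)%N -> w0 != 0 ->
  let q := (Num.sqrt n%:R)%:C in
  (q * w0 + tau *i) ^+ n *
    cexp ((q * w0 + tau *i - q * (w0 + w0^-1)) ^+ 2 / 2) =
  q ^+ n * w0 ^+ n * cexp (n%:R * (w0 ^- 2 / 2)) * saddle_integrand n w0 tau.
Proof.
move=> n0 w00 q.
have q2 : q ^+ 2 = n%:R by rewrite -rmorphXn sqr_sqrtr ?ler0n// rmorph_nat.
have q0 : q != 0 by rewrite -sqrf_eq0 q2 pnatr_eq0 -lt0n.
pose v := tau *i / (q * w0).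
have -> : q * w0 + tau *i = q * w0 * (1 + v).
  by rewrite mulrDr mulr1 [X in _ = _ + X]mulrC /v divfK// mulf_neq0.
have := saddle_factor v 0 q2 w00.
by rewrite addr0 !mul0r subr0 expr0n /= mul0r cexp0 mulr1.
Qed.

(** Here [v] is of order [n ^ (- 1 / 2)]: the quadratic term has a limit and the
    cubic one disappears. *)
Lemma ccvg_saddle_integrand (w0 : R[i]) tau : w0 != 0 ->
  ccvg (fun n => saddle_integrand n w0 tau)
       (cexp ((w0 ^- 2 - 1) * tau%:C ^+ 2 / 2)).
Proof.
move=> w00; pose z : R[i] := tau *i / w0.
pose y n : R := (Num.sqrt n%:R)^-1.
have vE n : tau *i / ((Num.sqrt n%:R)%:C * w0) = z * (y n)%:C.
  by rewrite /z /y fmorphV invfM mulrA mulrAC.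
have ny2 n : (0 < n)%N -> n%:R * y n ^+ 2 = 1.
  by move=> n0; rewrite exprVn sqr_sqrtr ?ler0n// divff// pnatr_eq0 -lt0n.
have y0 n : 0 <= y n by rewrite invr_ge0 sqrtr_ge0.
apply: (@ccvg_saddle w0 _ (fun n => tau *i / ((Num.sqrt n%:R)%:C * w0))).
- under eq_fun do rewrite vE normcM normc_real ger0_norm// exprMn.
  have : y n * y n * normc z ^+ 4 @[n --> \oo] --> (0 : R) * 0 * normc z ^+ 4.
    by apply: cvgM; [apply: cvgM; exact: cvg_invsqrtn|exact: cvg_cst].
  rewrite !mul0r; apply: cvg_trans; apply: near_eq_cvg; near=> n.
  rewrite -[LHS]mul1r -[X in X * _ = _](ny2 n); last by near: n; exact: nbhs_infty_gt.
  ring.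
- apply: (@ccvg_normc _ _ _ (fun n => normc (z ^+ 3 / 3) * y n)); last first.
    by rewrite -(mulr0 (normc (z ^+ 3 / 3))); apply: cvgM;
      [exact: cvg_cst|exact: cvg_invsqrtn].
  near=> n; rewrite vE.
  have n0 : (0 < n)%N by near: n; exact: nbhs_infty_gt.
  have e1 : n%:R * (y n)%:C ^+ 2 = 1 :> R[i].
    by rewrite -(rmorph_nat (real_complex R)) -rmorphXn -rmorphM ny2// rmorph1.
  have ez : z ^+ 2 = - tau%:C ^+ 2 / w0 ^+ 2.
    rewrite /z expr_div_n; congr (_ / _); rewrite !expr2; simpc.
    by congr Complex; ring.
  have -> : n%:R * ((w0 ^+ 2 - 1) * (z * (y n)%:C) ^+ 2 / 2 + (z * (y n)%:C) ^+ 3 / 3)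
      - (w0 ^- 2 - 1) * tau%:C ^+ 2 / 2 = z ^+ 3 / 3 * (y n)%:C.
    have -> : n%:R * ((w0 ^+ 2 - 1) * (z * (y n)%:C) ^+ 2 / 2 +
        (z * (y n)%:C) ^+ 3 / 3) = (n%:R * (y n)%:C ^+ 2) *
        ((w0 ^+ 2 - 1) * z ^+ 2 / 2 + z ^+ 3 * (y n)%:C / 3) by ring.
    by rewrite e1 mul1r ez; field; rewrite ?w00 ?pnatr_eq0.
  by rewrite normcM normc_real ger0_norm.
Unshelve. all: by end_near. Qed.

Lemma ccontinuous_saddle_integrand n w0 : ccontinuous (saddle_integrand n w0).
Proof.
have cv : ccontinuous (fun tau : R => tau *i / ((Num.sqrt n%:R)%:C * w0)).
  apply: ccontinuousM; last exact: ccontinuous_cst.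
  by split => t /=; [exact: cvg_cst|exact: cvg_id].
apply: ccontinuousM.
  by apply: ccontinuousX; apply: ccontinuousD => //; exact: ccontinuous_cst.
apply: ccontinuous_cexp; apply: ccontinuousM; first exact: ccontinuous_cst.
apply: ccontinuousD.
  under eq_fun do rewrite -mulN1r; apply: ccontinuousM => //; exact: ccontinuous_cst.
apply: ccontinuousM; last exact: ccontinuous_cst.
by apply: ccontinuousM; [exact: ccontinuous_cst|exact: ccontinuousX].
Qed.

End saddle_points.

(** * Arguments above 2 sqrt n *)

Section outside.
Context {R : realType}.
Local Open Scope complex_scope.
Local Notation mu := (@lebesgue_measure R).
Local Notation halfline := `[0%R, +oo[%classic.

(** The saddle point [w0 = exp gamma] is real and the ray leaves it vertically,
    which is the direction of steepest descent. *)
Theorem He_asymp_outside (a gamma : R) : 1 < a -> 0 <= gamma -> a = cosh gamma ->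
  asymp_eq \oo
    (fun n => He n (2 * a * Num.sqrt n%:R))
    (fun n => n%:R `^ (n%:R / 2)
              * expR (n%:R * (gamma + 1 / 2 * expR (- (2 * gamma))))
              * (expR (gamma / 2) / Num.sqrt (2 * sinh gamma))).
Proof.
move=> a1 g0 aE.
have gp : 0 < gamma.
  rewrite lt_neqAle g0 andbT; apply/eqP => gE; move: a1.
  by rewrite aE -gE /cosh oppr0 expR0; lra.
pose w0 : R := expR gamma; have w0p : 0 < w0 := expR_gt0 _.
have w0V : w0^-1 = expR (- gamma) by rewrite expRN.
pose b : R := 1 - expR (- (2 * gamma)).
have bp : 0 < b by rewrite subr_gt0 -expR0 ltr_expR oppr_lt0 mulr_gt0.
have wC0 : w0%:C != 0 :> R[i] by rewrite fmorph_eq0 gt_eqF.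
have w2 : w0 ^- 2 = expR (- (2 * gamma)) :> R.
  by rewrite expRN expRM_natl.
pose M n : R := Num.sqrt n%:R ^+ n * expR (n%:R * (gamma + 1 / 2 * expR (- (2 * gamma)))).
pose I n : R[i] := Cintegral halfline (saddle_integrand n w0%:C).
(* The modulus is at most exp (- b s ^ 2 / 2), and s - b s ^ 2 / 2 has the
   maximum 1 / (2 b). *)
pose K := expR (1 / (2 * b)); have K0 : 0 <= K := expR_ge0 _.
have bG n s : (0 < n)%N -> normc (saddle_integrand n w0%:C s) <= K * expR (- s).
  move=> n0; pose q : R := Num.sqrt n%:R.
  have q2 : q ^+ 2 = n%:R by rewrite sqr_sqrtr ?ler0n.
  have nr : n%:R != 0 :> R by rewrite pnatr_eq0 -lt0n.
  have q0 : q != 0 by rewrite -sqrf_eq0 q2.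
  have vE : s *i / (q%:C * w0%:C) = (s / (q * w0)) *i :> R[i].
    by rewrite -rmorphM -fmorphV; simpc.
  rewrite /saddle_integrand vE.
  apply: le_trans (@saddle_modulus _ _ _ (s ^+ 2 / (n%:R * w0 ^+ 2)) n _) _.
    rewrite normc_sqr /= add0r addr0 expr1n.
    have -> : (s / (q * w0)) ^+ 2 = s ^+ 2 / (n%:R * w0 ^+ 2).
      by rewrite expr_div_n exprMn q2.
    exact: expR_ge1Dx.
  have -> : Re (- (s / (q * w0)) *i + w0%:C ^+ 2 * (s / (q * w0)) *i ^+ 2 / 2) =
      - (s ^+ 2 / n%:R / 2).
    rewrite invC2.
    rewrite !expr2; simpc => /=; rewrite -q2; field.
    by rewrite q0 gt_eqF.
  rewrite /K -expRD ler_expR.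
  have -> : n%:R * (s ^+ 2 / (n%:R * w0 ^+ 2) / 2 - s ^+ 2 / n%:R / 2) =
      - (b * s ^+ 2 / 2).
    rewrite /b -w2; field; by rewrite nr gt_eqF.
  have : 0 <= (1 - b * s) ^+ 2 / (2 * b) by rewrite divr_ge0 ?sqr_ge0//; lra.
  have -> : (1 - b * s) ^+ 2 / (2 * b) = 1 / (2 * b) - s + b * s ^+ 2 / 2.
    by field; rewrite gt_eqF.
  lra.
have HeE n : (0 < n)%N ->
    He n (2 * a * Num.sqrt n%:R) = Num.sqrt (2 / pi) * (M n * Re (I n)).
  move=> n0; pose q : R := Num.sqrt n%:R.
  have hi : `|Re ('i : R[i])| < Im ('i : R[i]) by rewrite /= normr0.
  rewrite (He_hermite_ray n _ (q * w0) hi); congr (_ * _).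
  have eM s : Im (hermite_ray n (2 * a * q) (q * w0) 'i s) =
      M n * Re (saddle_integrand n w0%:C s).
    rewrite /hermite_ray.
    have -> : s%:C * 'i = s *i by simpc.
    have -> : (2 * a * q)%:C = q%:C * (w0%:C + w0%:C^-1).
      rewrite -fmorphV -rmorphD -rmorphM; congr (_%:C).
      by rewrite aE /cosh w0V /w0; field.
    rewrite rmorphM saddle_integrandE// mulrC ImiRe.
    have -> : q%:C ^+ n * w0%:C ^+ n * cexp (n%:R * (w0%:C ^- 2 / 2)) = (M n)%:C.
      have -> : n%:R * (w0%:C ^- 2 / 2) = (n%:R * (w0 ^- 2 / 2))%:C :> R[i].
        by rewrite !(rmorphM (real_complex R)) !fmorphV rmorphXn !rmorph_nat.
      rewrite cexpR -!rmorphXn -!rmorphM w2 /M -/q -mulrA.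
      congr (_ * _)%:C; rewrite /w0 -expRM_natl -expRD; congr expR; by field.
    by rewrite ReM /= mul0r subr0.
  under eq_Rintegral do rewrite eM.
  rewrite RintegralZl//; apply: (integrable_dominated K0).
    exact: (ccontinuous_saddle_integrand n w0%:C).1.
  by move=> s s0; apply: le_trans (Re_le_normc _) (bG n s n0).
(* The second derivative of the exponent at the saddle point is b = 1 - w0 ^- 2,
   so the limit Gaussian is the one along the direction i sqrt b. *)
pose zeta : R[i] := (Num.sqrt b) *i.
have sb0 : 0 < Num.sqrt b by rewrite sqrtr_gt0.
have hz : `|Re zeta| < Im zeta by rewrite /= normr0.
pose J := Cintegral halfline (fun s => cexp ((s%:C * zeta) ^+ 2 / 2)).
have JE : Re J = Num.sqrt (pi / 2) / Num.sqrt b.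
  have := Cintegral_gauss_ray hz; rewrite -/J => /(congr1 Im).
  by rewrite ImM /= mul0r add0r => <-; rewrite [RHS]mulrC mulKf// gt_eqF.
have z2 s : (s%:C * zeta) ^+ 2 / 2 = (w0%:C ^- 2 - 1) * s%:C ^+ 2 / 2.
  have -> : w0%:C ^- 2 - 1 = zeta ^+ 2.
    rewrite -rmorphXn -fmorphV w2 -(rmorph1 (real_complex R)) -rmorphB /zeta.
    rewrite [RHS]expr2; simpc; congr Complex.
    by rewrite -expr2 sqr_sqrtr ?ltW// /b opprB.
  by rewrite exprMn mulrC [in RHS]mulrC [_ ^+ 2 * _]mulrC.
have IJ : ccvg (fun n => I n.+1) J.
  apply: (@dominated_Cintegral_cvg _ _ _ _ (fun s => K * expR (- s))) => //.
  - by move=> n; apply: ccontinuous_measurable; exact: ccontinuous_saddle_integrand.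
  - move=> s _; rewrite z2.
    exact: (@ccvg_shiftS _ (fun n => saddle_integrand n w0%:C s) _
      (ccvg_saddle_integrand s wC0)).
  - exact: integrable_expRN.
  - by move=> n s _; exact: bG.
pose S := Num.sqrt (2 * sinh gamma); pose E := expR (gamma / 2).
have E0 : 0 < E := expR_gt0 _.
have E2 : E ^+ 2 = w0 by rewrite -expRM_natl /w0; congr expR; lra.
have sh : 2 * sinh gamma = w0 * b.
  rewrite /sinh /b /w0 mulrBr mulr1 -expRD mulrC divfK ?pnatr_eq0//.
  by congr (_ - expR _); lra.
have SE : S = E * Num.sqrt b.
  by rewrite /S sh sqrtrM ?ltW// -E2 sqrtr_sqr ger0_norm// ltW.
have S0 : 0 < S by rewrite SE mulr_gt0.
rewrite /asymp_eq -cvg_shiftS.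
have -> : (fun n => He n.+1 (2 * a * Num.sqrt n.+1%:R) /
    (n.+1%:R `^ (n.+1%:R / 2) *
     expR (n.+1%:R * (gamma + 1 / 2 * expR (- (2 * gamma)))) * (E / S))) =
    (fun n => Num.sqrt (2 / pi) * S / E * Re (I n.+1)).
  apply/funext => n; rewrite HeE// powR_half_mul -/(M n.+1).
  have : M n.+1 != 0.
    by rewrite gt_eqF// mulr_gt0 ?expR_gt0// exprn_gt0// sqrtr_gt0.
  by move=> M0; field; rewrite M0 !gt_eqF.
have key : Num.sqrt (2 / pi) * S / E * Re J = 1.
  have p0 : 0 < pi :> R by exact: pi_gt0.
  rewrite JE SE sqrtrM// sqrtrM ?ltW// !sqrtrV ?ltW//.
  by field; rewrite !gt_eqF ?sqrtr_gt0.
have : Num.sqrt (2 / pi) * S / E * Re (I n.+1) @[n --> \oo] -->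
    Num.sqrt (2 / pi) * S / E * Re J.
  by apply: cvgM; [exact: cvg_cst|exact: IJ.1].
by rewrite key.
Qed.

End outside.

(** * Arguments near 2 sqrt n and the Airy function *)

Section edge.
Context {R : realType}.
Local Open Scope complex_scope.
Local Notation mu := (@lebesgue_measure R).
Local Notation halfline := `[0%R, +oo[%classic.
Local Notation root6 n := ((n%:R : R) `^ (1 / 6)).

(** The coefficient 1 / 2 is needed below, where the terms of second order have to
    match exactly. *)
Lemma expR_ge_quadratic (x : R) : 0 <= x -> 1 + x + x ^+ 2 / 2 <= expR x.
Proof.
rewrite le_eqVlt => /predU1P[<-|x0]; first by rewrite expR0; lra.
pose f (t : R) := expR t - (1 + t + t ^+ 2 / 2).
have df (t : R) : is_derive t 1 f (expR t - (1 + t)).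
  apply: is_deriveB.
  have -> : (fun t : R => 1 + t + t ^+ 2 / 2) = cst 1 + id + 2^-1 \*: (id ^+ 2).
    by apply/funext => s /=; rewrite !fctE; congr (_ + _); exact: mulrC.
  by apply: is_derive_eq; rewrite /GRing.scale /=; field.
have cf : {within `[0, x], continuous f}.
  apply: continuous_subspaceT => t.
  by apply/differentiable_continuous/derivable1_diffP; have [] := df t.
have [c] := MVT x0 (fun t _ => df t) cf.
rewrite in_itv /= => /andP[c0 cx] fE.
have : 0 <= f x - f 0.
  by rewrite fE mulr_ge0 ?subr_ge0 ?expR_ge1Dx// ltW.
by rewrite /f expR0; lra.
Qed.

(** The left-hand side is the square of the modulus of [1 + s * exp (i pi / 3)], and
    the first two terms of the exponent cancel in the edge integrand. The gain in
    [s ^+ 3] gives a domination that is uniform in [n]. *)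
Lemma edge_modulus_bound (s : R) : 0 <= s ->
  1 + s + s ^+ 2 <= expR (s + s ^+ 2 / 2 - s ^+ 3 / (4 * (1 + s))).
Proof.
move=> s0; pose d := s / (1 + s).
have d0 : 0 <= d by rewrite divr_ge0//; lra.
have ds : d * (1 + s) = s by rewrite divfK// gt_eqF//; lra.
have -> : s ^+ 3 / (4 * (1 + s)) = s ^+ 2 * d / 4.
  by rewrite /d; field; rewrite gt_eqF//; lra.
have d1 : d <= 1 by rewrite ler_pdivrMr; lra.
have dls : d <= s by nra.
have sd : s * d <= s by nra.
pose X := s + s ^+ 2 / 2 - s ^+ 2 * d / 4.
have XE : X = s * (1 + s / 2 - s * d / 4) by rewrite /X; ring.
have g1 : 1 + s / 4 <= 1 + s / 2 - s * d / 4 by lra.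
have X0 : 0 <= X by rewrite XE mulr_ge0//; lra.
apply: le_trans (expR_ge_quadratic X0).
have : s ^+ 2 * (1 + s / 2) <= X ^+ 2.
  rewrite XE exprMn ler_wpM2l ?sqr_ge0//.
  apply: (@le_trans _ _ ((1 + s / 4) ^+ 2)); first by have := sqr_ge0 s; lra.
  by rewrite ler_sqr ?nnegrE; lra.
have : s ^+ 2 * d <= s ^+ 2 * s by rewrite ler_wpM2l ?sqr_ge0.
rewrite {2}/X; lra.
Qed.

Lemma cexp_pi3 : exists k l : R, [/\ cexp ((pi / 3) *i) = k +i* l :> R[i],
  k = 1 / 2, l ^+ 2 = 3 / 4 & 0 < l].
Proof.
pose k := cos (pi / 3 : R); pose l := sin (pi / 3 : R).
have p0 : 0 < pi :> R by exact: pi_gt0.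
have l0 : 0 < l by apply: sin_gt0_pihalf; apply/andP; split; lra.
have k0 : 0 < k by apply: cos_gt0_pihalf; apply/andP; split; lra.
have kl : k ^+ 2 + l ^+ 2 = 1 by exact: cos2Dsin2.
(* The triple angle formula determines the ratio of sine and cosine. *)
have : sin (pi / 3 + (pi / 3 + pi / 3) : R) = 0.
  by rewrite -(@sinpi R); congr sin; lra.
rewrite sinD [sin (_ + _)]sinD [cos (_ + _)]cosD -/k -/l => h.
have h2 : l * (3 * k ^+ 2 - l ^+ 2) = 0 by rewrite -[RHS]h; ring.
have {h2} /eqP : l * (3 * k ^+ 2 - l ^+ 2) == 0 by rewrite h2.
move=> /eqP; rewrite mulf_eq0 gt_eqF//= subr_eq0 => /eqP l2.
have k2 : k ^+ 2 = (1 / 2) ^+ 2 by lra.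
have kE : k = 1 / 2.
  by apply/eqP; rewrite -(@eqrXn2 _ 2)// ?ltW// ?k2//; lra.
exists k, l; split => //; last by lra.
by rewrite /cexp /= expR0 mul1r.
Qed.

Definition airy_integrand (u : R) (zeta : R[i]) (s : R) : R[i] :=
  zeta * cexp ((s%:C * zeta) ^+ 3 / 3 - u%:C * (s%:C * zeta)).

(** The two rays of the contour are conjugate to each other, so only the imaginary
    part of one of them remains. *)
Lemma Ai_ray (u : R) : Ai u = pi^-1 *
  \int[mu]_(s in halfline) Im (airy_integrand u (cexp ((pi / 3) *i)) s).
Proof.
set zeta := cexp _.
have zc : cexp ((- (pi / 3)) *i) = conjc zeta.
  by rewrite /zeta /cexp /= cosN sinN; simpc.
rewrite /Ai /AiC /ray_integral -/zeta zc; clearbody zeta => {zc}.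
have cj : {morph conjc : x y / x * y >-> x * y :> R[i]} by exact: rmorphM.
have cexpJ w : cexp (conjc w) = conjc (cexp w) :> R[i].
  by case: w => a b; rewrite /cexp /= cosN sinN; simpc.
have airyJ s : airy_integrand u (conjc zeta) s = conjc (airy_integrand u zeta s).
  rewrite /airy_integrand [RHS]cj -cexpJ; congr (_ * cexp _).
  have e3 : conjc 3^-1 = 3^-1 :> R[i] by rewrite (fmorphV (@conjc R)) rmorph_nat.
  have eB (a b : R[i]) : conjc (a - b) = conjc a - conjc b by exact: rmorphB.
  have eX (a : R[i]) : conjc (a ^+ 3) = conjc a ^+ 3 by exact: rmorphXn.
  by rewrite eB (cj (_ ^+ 3)) eX (cj u%:C) e3 (cj s%:C) !conjc_real.
have eI (z : R[i]) :
    Im (Cintegral halfline (fun s => cexp ((s%:C * z) ^+ 3 / 3 - u%:C * (s%:C * z)) * z)) =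
    \int[mu]_(s in halfline) Im (airy_integrand u z s).
  by apply: eq_Rintegral => s _; rewrite mulrC.
have := eI (conjc zeta); under [in RHS]eq_Rintegral do rewrite airyJ.
have -> : \int[mu]_(s in halfline) Im (conjc (airy_integrand u zeta s)) =
    - \int[mu]_(s in halfline) Im (airy_integrand u zeta s).
  by rewrite -Rintegral_opp; apply: eq_Rintegral => s _; case: airy_integrand.
rewrite -eI.
have p0 : pi != 0 :> R by rewrite gt_eqF// pi_gt0.
have -> : ((2 * pi) *i)^-1 = (- (2 * pi)^-1) *i :> R[i].
  have z0 : (2 * pi) *i != 0 :> R[i].
    by rewrite eq_complex /= negb_and mulf_neq0 ?orbT// pnatr_eq0.
  apply: (mulfI z0); rewrite divff//; simpc.
  by rewrite mulfV// mulf_neq0// pnatr_eq0.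
have : forall a b : R[i], Im b = - Im a ->
    Re ((- (2 * pi)^-1) *i * (a - b)) = pi^-1 * Im a.
  move=> [a b] [c d] bd; rewrite /= in bd; rewrite bd ReM ReD ImD /= invfM; lra.
exact.
Qed.

(** The contour in the variable [tau]: the saddle points merge at [w = q], and
    the distance to it is measured in units of [h = n ^ (1 / 6)]. *)
Definition edge_integrand n (u h : R) (zeta : R[i]) (tau : R) : R[i] :=
  let v := (tau / h ^+ 2)%:C * zeta in
  zeta * cexp (- (u%:C * (tau%:C * zeta))) *
    ((1 + v) ^+ n * cexp (n%:R * (- v + v ^+ 2 / 2))).

Lemma hermite_ray_edge n (u h : R) (zeta : R[i]) tau : 0 < h -> h ^+ 6 = n%:R ->
  hermite_ray n (2 * h ^+ 3 + h^-1 * u) (h ^+ 3) (h%:C * zeta) tau =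
  (h * h ^+ 3 ^+ n * expR (n%:R / 2 + u * h ^+ 2 + (u / h) ^+ 2 / 2))%:C *
  edge_integrand n u h zeta tau.
Proof.
move=> h0 hn; have hC0 : h%:C != 0 :> R[i] by rewrite fmorph_eq0 gt_eqF.
pose v : R[i] := (tau / h ^+ 2)%:C * zeta.
have eX (x : R) k : (x ^+ k)%:C = x%:C ^+ k :> R[i] by exact: rmorphXn.
have eM (x y : R) : (x * y)%:C = x%:C * y%:C :> R[i] by exact: rmorphM.
have eV (x : R) : (x^-1)%:C = x%:C^-1 :> R[i] by exact: fmorphV.
have eD (x y : R) : (x + y)%:C = x%:C + y%:C :> R[i] by exact: rmorphD.
have e2 : 2%:C = 2 :> R[i] by exact: rmorph_nat.
have en : (n%:R)%:C = n%:R :> R[i] by exact: rmorph_nat.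
have vE : v = tau%:C / h%:C ^+ 2 * zeta by rewrite /v eM eV eX.
have q2 : (h ^+ 3)%:C ^+ 2 = n%:R :> R[i] by rewrite -rmorphXn -exprM hn rmorph_nat.
have wE : (h ^+ 3)%:C + tau%:C * (h%:C * zeta) = (h ^+ 3)%:C * 1 * (1 + v).
  by rewrite vE eX; field.
have xE : (2 * h ^+ 3 + h^-1 * u)%:C = (h ^+ 3)%:C * (1 + 1^-1) + (u / h)%:C :> R[i].
  by rewrite eD !eM eV e2 invr1; ring.
rewrite /hermite_ray wE xE (saddle_factor v (u / h)%:C q2 (oner_neq0 _)).
rewrite /edge_integrand -/v !expr1n !mulr1 invr1 !mul1r.
have rE : (u / h)%:C ^+ 2 / 2 - (u / h)%:C * (h ^+ 3)%:C * (v - 1) =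
    (u * h ^+ 2 + (u / h) ^+ 2 / 2)%:C - u%:C * (tau%:C * zeta).
  have -> : (u * h ^+ 2 + (u / h) ^+ 2 / 2)%:C =
      u%:C * h%:C ^+ 2 + (u%:C / h%:C) ^+ 2 / 2.
    by rewrite eD (eM u) eX (eM ((u / h) ^+ 2)) eX (eM u) !eV e2.
  by rewrite vE eM eV eX; field.
rewrite rE cexpD.
have -> : (n%:R : R[i]) / 2 = (n%:R / 2)%:C by rewrite eM eV e2 en.
rewrite !cexpR -[n%:R / 2 + _ + _]addrA [expR (n%:R / 2 + _)]expRD.
by rewrite (eM (h * _)) (eM h) !(eX _ n) (eM (expR _)); ring.
Qed.

Lemma root6X n k : root6 n ^+ k = n%:R `^ (1 / 6 * k%:R).
Proof. by rewrite [RHS]powRrM powR_mulrn ?powR_ge0. Qed.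

Lemma root6X6 n : root6 n ^+ 6 = n%:R.
Proof. by rewrite root6X mul1r mulVf ?pnatr_eq0// powRr1 ?ler0n. Qed.

Lemma root6_ge1 n : 1 <= root6 n.+1.
Proof.
rewrite leNgt; apply/negP => h1.
have : root6 n.+1 ^+ 6 < 1 by rewrite exprn_ilt1 ?powR_ge0.
by rewrite root6X6 ltrn1.
Qed.

Lemma sqrt_root6 n : Num.sqrt n%:R = root6 n ^+ 3.
Proof.
have e : n%:R = (root6 n ^+ 3) ^+ 2 by rewrite -exprM root6X6.
by rewrite [in LHS]e sqrtr_sqr ger0_norm// exprn_ge0 ?powR_ge0.
Qed.

Lemma cvg_root6V : (root6 n)^-1 @[n --> \oo] --> (0 : R).
Proof.
apply/cvgrPdist_lt => e e0; near=> n.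
have h0 : 0 <= (root6 n)^-1 by rewrite invr_ge0 powR_ge0.
rewrite sub0r normrN ger0_norm// ltNge; apply/negP => eh.
have : e ^+ 6 <= n%:R^-1.
  by rewrite -root6X6 -exprVn lerXn2r ?nnegrE// ltW.
apply/negP; rewrite -ltNge; near: n.
by apply: (cvgr_lt _ cvg_invn); rewrite exprn_gt0.
Unshelve. all: by end_near. Qed.

Lemma ccontinuous_edge_integrand n (u h : R) zeta :
  ccontinuous (edge_integrand n u h zeta).
Proof.
have ct : ccontinuous (fun tau : R => tau%:C).
  by apply: ccontinuous_real => t; exact: cvg_id.
have cv : ccontinuous (fun tau : R => (tau / h ^+ 2)%:C * zeta).
  apply: ccontinuousM; last exact: ccontinuous_cst.
  by apply: ccontinuous_real => t; apply: cvgM; [exact: cvg_id|exact: cvg_cst].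
apply: ccontinuousM; last apply: ccontinuousM.
- apply: ccontinuousM; first exact: ccontinuous_cst.
  apply: ccontinuous_cexp; under eq_fun do rewrite -mulN1r.
  apply: ccontinuousM; first exact: ccontinuous_cst.
  apply: ccontinuousM; first exact: ccontinuous_cst.
  by apply: ccontinuousM => //; exact: ccontinuous_cst.
- by apply: ccontinuousX; apply: ccontinuousD => //; exact: ccontinuous_cst.
- apply: ccontinuous_cexp; apply: ccontinuousM; first exact: ccontinuous_cst.
  apply: ccontinuousD.
    by under eq_fun do rewrite -mulN1r; apply: ccontinuousM => //;
      exact: ccontinuous_cst.
  by apply: ccontinuousM; [exact: ccontinuousX|exact: ccontinuous_cst].
Qed.

(** Here [v] is of order [n ^ (- 1 / 3)], so [n * v ^+ 3] does not depend on [n] and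
    the limit is the exponential of a cubic. *)
Lemma ccvg_edge_integrand (u tau : R) zeta :
  ccvg (fun n => edge_integrand n u (root6 n) zeta tau)
       (airy_integrand u zeta tau).
Proof.
pose z : R[i] := tau%:C * zeta; pose y n : R := (root6 n)^-1.
have y0 n : 0 <= y n by rewrite invr_ge0 powR_ge0.
have vE n : (tau / root6 n ^+ 2)%:C * zeta = z * (y n ^+ 2)%:C.
  by rewrite /z /y exprVn [(tau / _)%:C]rmorphM mulrAC.
have ny n : (0 < n)%N -> n%:R * y n ^+ 6 = 1.
  by move=> n0; rewrite exprVn root6X6 divff// pnatr_eq0 -lt0n.
have -> : airy_integrand u zeta tau =
    zeta * cexp (- (u%:C * z)) * cexp (z ^+ 3 / 3).
  by rewrite /airy_integrand -mulrA -cexpD [- _ + _]addrC.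
apply: ccvgM; first exact: ccvg_cst.
have -> : (fun n => (1 + (tau / root6 n ^+ 2)%:C * zeta) ^+ n *
    cexp (n%:R * (- ((tau / root6 n ^+ 2)%:C * zeta) +
                  ((tau / root6 n ^+ 2)%:C * zeta) ^+ 2 / 2))) =
  (fun n => (1 + z * (y n ^+ 2)%:C) ^+ n *
    cexp (n%:R * (- (z * (y n ^+ 2)%:C) + 1 ^+ 2 * (z * (y n ^+ 2)%:C) ^+ 2 / 2))).
  by apply/funext => n; rewrite vE expr1n mul1r.
apply: ccvg_saddle.
- have : y n * y n * normc z ^+ 4 @[n --> \oo] --> (0 : R) * 0 * normc z ^+ 4.
    by apply: cvgM; [apply: cvgM; exact: cvg_root6V|exact: cvg_cst].
  rewrite !mul0r; apply: cvg_trans; apply: near_eq_cvg; near=> n.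
  rewrite normcM normc_real ger0_norm ?exprn_ge0// exprMn.
  rewrite -[LHS]mul1r -[X in X * _ = _](ny n); last by near: n; exact: nbhs_infty_gt.
  ring.
- apply: (@ccvg_normc _ _ _ (fun=> 0)); last exact: cvg_cst.
  near=> n.
  have n0 : (0 < n)%N by near: n; exact: nbhs_infty_gt.
  have e1 : n%:R * (y n ^+ 2)%:C ^+ 3 = 1 :> R[i].
    rewrite -(rmorph_nat (real_complex R)) -rmorphXn -rmorphM -exprM.
    by rewrite [_ * _](ny n n0) rmorph1.
  rewrite expr1n subrr !mul0r add0r exprMn.
  have -> : n%:R * (z ^+ 3 * (y n ^+ 2)%:C ^+ 3 / 3) =
      n%:R * (y n ^+ 2)%:C ^+ 3 * (z ^+ 3 / 3) by ring.
  by rewrite e1 mul1r subrr ComplexField.Normc.normc0.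
Unshelve. all: by end_near. Qed.

(** The modulus is at most [exp (|u| tau - tau ^+ 3 / (8 * (1 + tau)))], which decays
    like a Gaussian. *)
Lemma edge_integrand_dominated (u : R) : exists2 K, 0 <= K &
  forall n tau, (0 < n)%N -> 0 <= tau ->
  normc (edge_integrand n u (root6 n) (cexp ((pi / 3) *i)) tau) <=
  K * expR (- tau).
Proof.
have [k [l [-> kE l2 l0]]] := cexp_pi3.
(* b is the rate of the linear terms, and 2 b ^ 2 the maximum of
   b tau - tau ^ 2 / 8. *)
pose b := 1 / 8 + `|u| + 1.
exists (expR (2 * b ^+ 2)) => [|n tau n0 t0]; first exact: expR_ge0.
have n1 : (0 < n)%N := n0; case: n n0 n1 => // n _ _.
set h := root6 n.+1; have h1 : 1 <= h := root6_ge1 n.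
have h0 : 0 < h by lra.
have hn : h ^+ 6 = n.+1%:R := root6X6 _.
pose s := tau / h ^+ 2; have s0 : 0 <= s by rewrite divr_ge0// sqr_ge0.
have st : s <= tau.
  by rewrite ler_pdivrMr ?exprn_gt0// ler_peMr// exprn_ege1.
rewrite /edge_integrand -/s normcM.
have kl : k ^+ 2 + l ^+ 2 = 1 by rewrite kE l2; field.
apply: (@le_trans _ _ (expR (`|u| * tau) *
    expR (n.+1%:R * ((s + s ^+ 2 / 2 - s ^+ 3 / (4 * (1 + s))) / 2 +
                     (- (s / 2) - s ^+ 2 / 4))))).
  apply: ler_pM; rewrite ?normc_ge0//.
    rewrite normcM normc_cexp.
    have -> : normc (k +i* l) = 1 by rewrite /= kl sqrtr1.
    rewrite mul1r ler_expR; simpc => /=; rewrite ?mul0r ?subr0 kE.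
    have := ler_norm (- u); rewrite normrN => ul.
    have : - u * tau <= `|u| * tau by rewrite ler_wpM2r.
    have : 0 <= `|u| * tau by rewrite mulr_ge0.
    lra.
  have -> : - (s / 2) - s ^+ 2 / 4 =
      Re (- (s%:C * (k +i* l)) + (s%:C * (k +i* l)) ^+ 2 / 2).
    rewrite invC2.
    rewrite expr2; simpc => /=; rewrite kE.
    have -> : s * l * (s * l) = s ^+ 2 * l ^+ 2 by ring.
    by rewrite l2; field.
  apply: saddle_modulus; apply: le_trans (edge_modulus_bound s0).
  rewrite normc_sqr; simpc => /=.
  have -> : (s * l) ^+ 2 = s ^+ 2 * l ^+ 2 by ring.
  by rewrite l2 kE; lra.
rewrite -!expRD ler_expR.
have -> : n.+1%:R * ((s + s ^+ 2 / 2 - s ^+ 3 / (4 * (1 + s))) / 2 +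
    (- (s / 2) - s ^+ 2 / 4)) = - (tau ^+ 3 / (8 * (1 + s))).
  rewrite -hn /s; field.
  by rewrite !gt_eqF// ltr_wpDr ?exprn_gt0.
have : tau ^+ 3 / (8 * (1 + tau)) <= tau ^+ 3 / (8 * (1 + s)).
  by rewrite ler_wpM2l ?exprn_ge0// lef_pV2 ?posrE; lra.
have : (tau ^+ 2 - tau) / 8 <= tau ^+ 3 / (8 * (1 + tau)).
  by rewrite ler_pdivlMr; nra.
have := sqr_ge0 (tau - 4 * b); rewrite /b; nra.
Qed.

Theorem He_asymp_edge (u : R) :
  let x n := 2 * Num.sqrt n%:R + n%:R `^ (- (1 / 6)) * u in
  let A n := Num.sqrt (2 * pi) * expR (n%:R / 2) * n%:R `^ (n%:R / 2)
             * n%:R `^ (1 / 6) * expR (u * n%:R `^ (1 / 3)) in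
  (He n (x n) / A n @[n --> \oo] --> Ai u) /\
  (Ai u != 0 ->
   asymp_eq \oo (fun n => He n (x n)) (fun n => A n * Ai u)).
Proof.
move=> x A; pose zeta : R[i] := cexp ((pi / 3) *i).
pose I n : R[i] := Cintegral halfline (edge_integrand n u (root6 n) zeta).
have [K K0 bK] := edge_integrand_dominated u.
have hz : `|Re zeta| < Im zeta.
  rewrite /zeta; have [k [l [-> kE l2 l0]]] := cexp_pi3.
  by rewrite /= kE ger0_norm; nra.
have p0 : 0 < pi :> R by exact: pi_gt0.
have ratioE n : He n.+1 (x n.+1) / A n.+1 =
    pi^-1 * expR ((u * (root6 n.+1)^-1) * (u * (root6 n.+1)^-1) / 2) * Im (I n.+1).
  have h1 := root6_ge1 n; set h := root6 n.+1 in h1 *.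
  have h0 : 0 < h by lra.
  have hn : h ^+ 6 = n.+1%:R := root6X6 _.
  have xE : x n.+1 = 2 * h ^+ 3 + h^-1 * u.
    by rewrite /x sqrt_root6 -/h powRN.
  have hhz : `|Re (h%:C * zeta)| < Im (h%:C * zeta).
    have e (z : R[i]) : Re (h%:C * z) = h * Re z /\ Im (h%:C * z) = h * Im z.
      by rewrite ReM ImM /= !mul0r subr0 addr0.
    by rewrite (e _).1 (e _).2 normrM (gtr0_norm h0) ltr_pM2l.
  rewrite xE (He_hermite_ray n.+1 _ (h ^+ 3) hhz).
  pose P := h * h ^+ 3 ^+ n.+1 * expR (n.+1%:R / 2 + u * h ^+ 2 + (u / h) ^+ 2 / 2).
  have eI s : Im (hermite_ray n.+1 (2 * h ^+ 3 + h^-1 * u) (h ^+ 3) (h%:C * zeta) s) =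
      P * Im (edge_integrand n.+1 u h zeta s).
    by rewrite hermite_ray_edge// ImM /= mul0r addr0.
  under eq_Rintegral do rewrite eI.
  rewrite RintegralZl//; last first.
    apply: (integrable_dominated K0).
      exact: (ccontinuous_edge_integrand n.+1 u h zeta).2.
    by move=> s s0; apply: le_trans (Im_le_normc _) (bK n.+1 s isT s0).
  rewrite -[Rintegral _ _ _]/(Im (I n.+1)).
  have -> : A n.+1 = Num.sqrt (2 * pi) * expR (n.+1%:R / 2) * h ^+ 3 ^+ n.+1 * h *
      expR (u * h ^+ 2).
    rewrite /A powR_half_mul sqrt_root6 -/h; congr (_ * expR (u * _)).
    by rewrite root6X; congr (_ `^ _); field.
  have s2 : Num.sqrt (2 * pi) != 0 :> R by rewrite gt_eqF// sqrtr_gt0 mulr_gt0.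
  have -> : Num.sqrt (2 / pi) = Num.sqrt (2 * pi) / pi :> R.
    have e (t : R) : t != 0 -> 2 / t = (2 * t) / t ^+ 2 by move=> t0; field.
    rewrite e ?gt_eqF//.
    by rewrite sqrtrM ?mulr_ge0// ?ltW// sqrtrV ?sqr_ge0// sqrtr_sqr gtr0_norm.
  rewrite /P !expRD -expr2.
  move: (Num.sqrt _) s2 (pi^-1) => S2 s2 V; field.
  by rewrite s2 !gt_eqF ?expR_gt0 ?exprn_gt0.
have IJ : Im (I n.+1) @[n --> \oo] -->
    Im (Cintegral halfline (airy_integrand u zeta)).
  apply: (@dominated_Cintegral_cvg _ _ (fun n => edge_integrand n.+1 u (root6 n.+1) zeta)
    _ (fun s => K * expR (- s)) _ _ _ _ _).2 => //.
  - by move=> n; apply: ccontinuous_measurable; exact: ccontinuous_edge_integrand.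
  - move=> s _.
    exact: (@ccvg_shiftS _ (fun n => edge_integrand n u (root6 n) zeta s) _
      (ccvg_edge_integrand u s zeta)).
  - exact: integrable_expRN.
  - by move=> n s; rewrite /= in_itv /= andbT => s0; exact: bK.
have lim : He n (x n) / A n @[n --> \oo] --> Ai u.
  rewrite -cvg_shiftS; under eq_fun do rewrite ratioE.
  have yc : u * (root6 n.+1)^-1 @[n --> \oo] --> u * 0.
    apply: cvgM; first exact: cvg_cst.
    by rewrite (cvg_shiftS (fun n => (root6 n)^-1)); exact: cvg_root6V.
  have : pi^-1 * expR (u * (root6 n.+1)^-1 * (u * (root6 n.+1)^-1) / 2) * Im (I n.+1)
      @[n --> \oo] --> pi^-1 * expR (u * 0 * (u * 0) / 2) *
        Im (Cintegral halfline (airy_integrand u zeta)).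
    apply: cvgM; last exact: IJ.
    apply: cvgM; first exact: cvg_cst.
    apply: continuous_cvg; first exact: continuous_expR.
    by apply: cvgM; [exact: cvgM|exact: cvg_cst].
  by rewrite mulr0 !mul0r expR0 mulr1 Ai_ray.
split => // Ai0; rewrite /asymp_eq -(divff Ai0).
under eq_fun do rewrite invfM mulrA.
by apply: cvgM => //; exact: cvg_cst.
Qed.

End edge.

(** * Arguments below 2 sqrt n *)

Section inside.
Context {R : realType}.
Local Open Scope complex_scope.
Local Notation mu := (@lebesgue_measure R).
Local Notation halfline := `[0%R, +oo[%classic.

(** Where [c] stays away from 0, an error that is small with respect to the
    amplitude is small with respect to [A * c]. *)
Lemma osc_asymp_eqP (f A c : nat -> R) : (forall n, A n != 0) ->
  f n / A n - c n @[n --> \oo] --> (0 : R) -> osc_asymp_eq f A c.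
Proof.
move=> A0 fAc; split => // delta d0; apply/cvgrPdist_lt => e e0.
have ed : 0 < e * delta by rewrite mulr_gt0.
rewrite near_withinE; near=> n => dn.
have c0 : 0 < `|c n| by rewrite (lt_le_trans d0).
have cn0 : c n != 0 by rewrite -normr_gt0.
have -> : 1 - f n / (A n * c n) = - ((f n / A n - c n) / c n).
  by field; rewrite cn0 A0.
rewrite normrN normrM normfV ltr_pdivrMr//.
apply: (@lt_le_trans _ _ (e * delta)); last by rewrite ler_wpM2l// ltW.
near: n; have /cvgrPdist_lt/(_ _ ed) := fAc.
by apply: filterS => n; rewrite sub0r normrN.
Unshelve. all: by end_near. Qed.

(** For [0 <= y] this is the quadratic lower bound of [expR]; for [y < 0] the square
    of the linear bound at [y / 2 - y ^+ 2 / 8] is enough. *)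
Lemma expR_ge1D_quadratic (y : R) : -1 <= y ->
  1 + y <= expR (y - y ^+ 2 / (4 * (1 + `|y|))).
Proof.
have [y0 _|y0 y1] := leP 0 y.
  rewrite ger0_norm//; pose d := y / (1 + y).
  have d0 : 0 <= d by rewrite divr_ge0//; lra.
  have d1 : d <= 1 by rewrite ler_pdivrMr; lra.
  have -> : y ^+ 2 / (4 * (1 + y)) = y * d / 4.
    by rewrite /d; field; rewrite gt_eqF//; lra.
  have ds : d * (1 + y) = y by rewrite divfK// gt_eqF//; lra.
  have yd : y * d <= y by nra.
  have X0 : 0 <= y - y * d / 4 by lra.
  apply: le_trans (expR_ge_quadratic X0).
  have : (3 / 4 * y) ^+ 2 <= (y - y * d / 4) ^+ 2.
    by rewrite ler_sqr ?nnegrE; lra.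
  have dy : d <= y by nra.
  have : y * d <= y * y by rewrite ler_wpM2l.
  lra.
have -> : `|y| = - y by rewrite ltr0_norm.
pose x := - y + y ^+ 2 / 4.
apply: (@le_trans _ _ (expR (- x))); last first.
  rewrite ler_expR /x opprD opprK lerB// ler_wpM2l ?sqr_ge0//.
  by rewrite lef_pV2 ?posrE; lra.
have x2 : x <= 2 by rewrite /x; nra.
apply: (@le_trans _ _ ((1 - x / 2) ^+ 2)).
  have -> : (1 - x / 2) ^+ 2 = 1 + y + y ^+ 2 * ((1 - y / 4) ^+ 2 - 1) / 4.
    by rewrite /x; field.
  by rewrite lerDl mulr_ge0// mulr_ge0 ?sqr_ge0// subr_ge0 exprn_ege1//; lra.
have -> : - x = 2%:R * (- (x / 2)) by field.
rewrite expRM_natl ler_sqr ?nnegrE ?expR_ge0//; last by lra.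
by have := expR_ge1Dx (- (x / 2)).
Qed.

(** On the vertical line through [w0 = a +i* s], the point [w / q] has squared
    modulus [1 + y] with [y = t * (2 * s + t)], [t = tau / q], and the modulus of the
    integrand is the [n]-th power of [sqrt (1 + y) * exp (- y / 2)]. In the upper half
    plane [2 * s + t >= s], so [|y|] is bounded below by [|t| * s]. *)
Lemma saddle_integrand_dominated_arc n (a s tau : R) : (0 < n)%N ->
  a ^+ 2 + s ^+ 2 = 1 -> 0 < s -> - (Num.sqrt n%:R * s) <= tau ->
  normc (saddle_integrand n (a +i* s) tau) <=
  expR (1 / 8) * expR (- (s / 8 * `|tau|)).
Proof.
move=> n0 as1 s0 tb; pose q : R := Num.sqrt n%:R.
have q2 : q ^+ 2 = n%:R by rewrite sqr_sqrtr ?ler0n.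
have q1 : 1 <= q by rewrite -(@sqrtr1 R) ler_wsqrtr// ler1n.
have q0 : 0 < q by lra.
have qC0 : q%:C != 0 :> R[i] by rewrite fmorph_eq0 gt_eqF.
pose t := tau / q.
have ts : - s <= t by rewrite ler_pdivlMr// mulNr mulrC.
have tq : tau = q * t by rewrite /t mulrC divfK// gt_eqF.
have w00 : a +i* s != 0 :> R[i].
  by rewrite eq_complex /= negb_and [s == _]gt_eqF// orbT.
have vE : tau *i / (q%:C * (a +i* s)) = (t * s) +i* (t * a).
  apply: (mulIf (mulf_neq0 qC0 w00)); rewrite divfK ?mulf_neq0// tq.
  simpc; congr Complex; first by ring.
  by transitivity (q * t * (a ^+ 2 + s ^+ 2)); [rewrite as1 mulr1|ring].
rewrite /saddle_integrand vE.
pose y := 2 * s * t + t ^+ 2.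
have yE : normc (1 + (t * s) +i* (t * a)) ^+ 2 = 1 + y.
  rewrite normc_sqr /= add0r /y.
  transitivity (1 + 2 * s * t + t ^+ 2 * (a ^+ 2 + s ^+ 2)); first by ring.
  by rewrite as1; ring.
have y1 : -1 <= y by have := sqr_ge0 (normc (1 + (t * s) +i* (t * a))); rewrite yE; lra.
have zy : normc (1 + (t * s) +i* (t * a)) ^+ 2 <=
    expR (y - y ^+ 2 / (4 * (1 + `|y|))).
  by rewrite yE expR_ge1D_quadratic.
apply: le_trans (saddle_modulus _ n zy) _.
have wv : (a +i* s) * ((t * s) +i* (t * a)) = t *i :> R[i].
  simpc; congr Complex; first by ring.
  by transitivity (t * (a ^+ 2 + s ^+ 2)); [ring|rewrite as1 mulr1].
have -> : Re (- (t * s) +i* (t * a) +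
    (a +i* s) ^+ 2 * ((t * s) +i* (t * a)) ^+ 2 / 2) = - (y / 2).
  rewrite invC2.
  by rewrite -exprMn wv ReD ReM expr2; simpc => /=; rewrite /y; field.
rewrite -expRD ler_expR.
have -> : n%:R * ((y - y ^+ 2 / (4 * (1 + `|y|))) / 2 + - (y / 2)) =
    - (q ^+ 2 * (`|y| ^+ 2 / (1 + `|y|)) / 8).
  rewrite q2 real_normK ?num_real//; field.
  by rewrite gt_eqF// ltr_pwDl.
(* The map y |-> y ^ 2 / (1 + y) is increasing, so |y| may be replaced by rho. *)
pose rho := `|t| * s.
have rho0 : 0 <= rho by rewrite mulr_ge0// ltW.
have yrho : rho <= `|y|.
  have -> : y = t * (2 * s + t) by rewrite /y; ring.
  by rewrite normrM ler_wpM2l// ger0_norm; lra.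
have h1 : rho ^+ 2 / (1 + rho) <= `|y| ^+ 2 / (1 + `|y|).
  rewrite ler_pdivrMr; last by lra.
  rewrite mulrAC ler_pdivlMr; last by lra.
  have : 0 <= (`|y| - rho) * (`|y| + rho + `|y| * rho).
    apply: mulr_ge0; first by rewrite subr_ge0.
    by rewrite !addr_ge0// mulr_ge0.
  lra.
have h2 : q * rho - 1 <= q ^+ 2 * (rho ^+ 2 / (1 + rho)).
  rewrite [leRHS]mulrA ler_pdivlMr; last by lra.
  have : rho <= q * rho by rewrite ler_peMl.
  have := sqr_ge0 (q * rho); have := mulr_ge0 (ltW q0) rho0; nra.
have h3 : q ^+ 2 * (rho ^+ 2 / (1 + rho)) <= q ^+ 2 * (`|y| ^+ 2 / (1 + `|y|)).
  by rewrite ler_wpM2l ?sqr_ge0.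
have -> : s / 8 * `|tau| = q * rho / 8.
  by rewrite tq normrM (gtr0_norm q0) /rho; ring.
lra.
Qed.

(** The part of the vertical line through the saddle point [w0] that lies in the
    upper half-plane, which exhausts the line as [n] grows. *)
Definition truncated_saddle n (w0 : R[i]) (tau : R) : R[i] :=
  if - (Num.sqrt n%:R * Im w0) <= tau then saddle_integrand n w0 tau else 0.

Lemma measurable_truncated_saddle n w0 :
  measurable_fun setT (Re \o truncated_saddle n w0) /\
  measurable_fun setT (Im \o truncated_saddle n w0).
Proof.
have [c1 c2] := ccontinuous_saddle_integrand n w0.
pose D : set R := `[- (Num.sqrt n%:R * Im w0), +oo[%classic.
have E (L : R[i] -> R) : L 0 = 0 -> continuous (L \o saddle_integrand n w0) ->
    measurable_fun setT (L \o truncated_saddle n w0).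
  move=> L0 cL; have -> : L \o truncated_saddle n w0 =
      (L \o saddle_integrand n w0) \_ D.
    apply/funext => t; rewrite /patch /truncated_saddle /= /D mem_setE in_itv /= andbT.
    by case: ifP.
  have mD : measurable D by exact: measurable_itv.
  by apply/(measurable_restrictT _ mD); exact: continuous_measurable_in.
by split; exact: E.
Qed.

Lemma ccvg_truncated_saddle (w0 : R[i]) tau : 0 < Im w0 ->
  ccvg (fun n => truncated_saddle n w0 tau)
       (cexp ((w0 ^- 2 - 1) * tau%:C ^+ 2 / 2)).
Proof.
move=> s0; have w00 : w0 != 0.
  by apply: contraTneq s0 => ->; rewrite /= ltxx.
have tn : \forall n \near \oo, - (Num.sqrt n%:R * Im w0) <= tau.
  have h : `|tau| * (Num.sqrt n%:R)^-1 @[n --> \oo] --> `|tau| * 0.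
    by apply: cvgM; [exact: cvg_cst|exact: cvg_invsqrtn].
  rewrite mulr0 in h; near=> n.
  have q0 : 0 < Num.sqrt n%:R :> R.
    by rewrite sqrtr_gt0 ltr0n; near: n; exact: nbhs_infty_gt.
  have : `|tau| * (Num.sqrt n%:R)^-1 < Im w0.
    by near: n; exact: (cvgr_lt _ h).
  rewrite ltr_pdivrMr// mulrC => th.
  by have := ler_norm (- tau); rewrite normrN; lra.
have [h1 h2] := ccvg_saddle_integrand tau w00.
split.
- apply: cvg_trans h1; apply: near_eq_cvg; near=> n; rewrite /truncated_saddle.
  by rewrite (near tn n).
- apply: cvg_trans h2; apply: near_eq_cvg; near=> n; rewrite /truncated_saddle.
  by rewrite (near tn n).
Unshelve. all: by end_near. Qed.

(** The vertical ray from [q * cos alpha] passes through the saddle point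
    [exp (i alpha)], at which it is centred. The limit is a Gaussian integral over
    the line along a direction [zeta] with [zeta ^+ 2 = w0 ^- 2 - 1], which lies in
    the cone of admissible rays. *)
Theorem He_asymp_inside (alpha : R) : 0 < alpha < pi / 2 ->
  osc_asymp_eq
    (fun n => He n (2 * cos alpha * Num.sqrt n%:R))
    (fun n => n%:R `^ (n%:R / 2)
              * Num.sqrt (2 / sin alpha)
              * expR (n%:R * (cos alpha ^+ 2 - 1 / 2)))
    (fun n => cos (n%:R * (sin alpha * cos alpha - alpha)
                   - 1 / 2 * (alpha - pi / 2))).
Proof.
move=> a01; have /andP[al0 alpi] := a01.
pose a := cos alpha; pose s := sin alpha; pose w0 : R[i] := a +i* s.
have s0 : 0 < s by exact: sin_gt0_pihalf.
have as1 : a ^+ 2 + s ^+ 2 = 1 by exact: cos2Dsin2.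
have w00 : w0 != 0 by rewrite eq_complex /= negb_and [s == _]gt_eqF// orbT.
have w0V : w0^-1 = a -i* s.
  apply: (mulfI w00); rewrite divff// /w0; simpc.
  by rewrite -!expr2 as1 [s * a]mulrC addNr.
have w0E : w0 = cexp (alpha *i) by rewrite /cexp /= expR0 mul1r.
have bM n : 0 < expR (n%:R * (a ^+ 2 - 1 / 2)) by exact: expR_gt0.
pose m n := Num.sqrt n%:R ^+ n * expR (n%:R * (a ^+ 2 - 1 / 2)).
pose theta n := n%:R * alpha - n%:R * (s * a).
pose amp := Num.sqrt (2 / s).
have amp0 : 0 < amp by rewrite sqrtr_gt0 divr_gt0.
have sqrtn0 n : Num.sqrt n%:R ^+ n != 0 :> R.
  by case: n => [|n]; rewrite ?expr0 ?oner_neq0// expf_neq0// gt_eqF// sqrtr_gt0.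
apply: osc_asymp_eqP => [n|].
  by rewrite powR_half_mul !mulf_neq0// gt_eqF.
pose K := expR (1 / 8 : R); have K0 : 0 <= K := expR_ge0 _.
pose I n := Cintegral setT (truncated_saddle n w0).
pose dom (tau : R) := K * expR (- (s / 8 * `|tau|)).
have s80 : 0 < s / 8 by rewrite divr_gt0.
have idom : mu.-integrable setT (EFin \o dom) by exact: integrable_expRN_norm.
have bT n tau : (0 < n)%N -> normc (truncated_saddle n w0 tau) <= dom tau.
  move=> n0; rewrite /truncated_saddle; case: ifPn => [tb|_].
    exact: saddle_integrand_dominated_arc.
  by rewrite ComplexField.Normc.normc0 mulr_ge0 ?expR_ge0.
(* Im w0 = s > 0: the vertex of the ray corresponds to tau = - q * s, so the
   integral over the ray is that of the truncated integrand over the line. *)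
have HeE n : (0 < n)%N -> He n (2 * a * Num.sqrt n%:R) =
    Num.sqrt (2 / pi) * (m n * Re (cexp ((theta n) *i) * I n)).
  move=> n0; pose q : R := Num.sqrt n%:R.
  have hi : `|Re ('i : R[i])| < Im ('i : R[i]) by rewrite /= normr0.
  rewrite (He_hermite_ray n _ (q * a) hi); congr (_ * _).
  pose M := (m n)%:C * cexp ((theta n) *i).
  have PM : q%:C ^+ n * w0 ^+ n * cexp (n%:R * (w0 ^- 2 / 2)) = M.
    have w2 : w0 ^- 2 = (a ^+ 2 - s ^+ 2) +i* (- (2 * s * a)).
      by rewrite -exprVn w0V expr2; simpc; congr Complex; ring.
    have enR : (n%:R : R[i]) = (n%:R : R)%:C by rewrite rmorph_nat.
    have e2R := @invC2 R.
    rewrite w2 w0E cexpX -[LHS]mulrA -cexpD /M /m -/q.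
    have -> : (q ^+ n * expR (n%:R * (a ^+ 2 - 1 / 2)))%:C =
        q%:C ^+ n * (expR (n%:R * (a ^+ 2 - 1 / 2)))%:C.
      by rewrite -rmorphXn -rmorphM.
    rewrite -[RHS]mulrA.
    congr (_ * _); rewrite -cexpR -cexpD; congr cexp; rewrite enR e2R; simpc.
    rewrite /theta (_ : s ^+ 2 = 1 - a ^+ 2); last by lra.
    by congr Complex; field.
  have eM tau : hermite_ray n (2 * a * q) (q * a) 'i (tau + q * s) =
      'i * M * saddle_integrand n w0 tau.
    rewrite /hermite_ray.
    have -> : (q * a)%:C + (tau + q * s)%:C * 'i = q%:C * w0 + tau *i.
      by rewrite /w0; simpc; congr Complex; ring.
    have -> : (2 * a * q)%:C = q%:C * (w0 + w0^-1).
      by rewrite w0V /w0; simpc; congr Complex; ring.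
    by rewrite saddle_integrandE// PM mulrA.
  have cI : continuous (fun t => Im (hermite_ray n (2 * a * q) (q * a) 'i t)).
    exact: (ccontinuous_hermite_ray _ _ _ _).2.
  (* The origin of the parameter is moved to the saddle point. *)
  rewrite (Rintegral_shift (q * s) cI) Rintegral_mkcond.
  have -> : \int[mu]_x ((fun tau => Im (hermite_ray n (2 * a * q) (q * a) 'i (tau + q * s)))
      \_ `[(- (q * s))%R, +oo[%classic) x =
      Im (Cintegral setT (fun t => 'i * M * truncated_saddle n w0 t)).
    apply: eq_Rintegral => t _; rewrite /patch /truncated_saddle mem_setE in_itv /= andbT.
    by case: ifP => _; [rewrite eM|rewrite mulr0].
  rewrite CintegralZl//; last 2 first.
  - apply: le_integrable idom => //.
      by apply/measurable_EFinP; exact: (measurable_truncated_saddle n w0).1.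
    move=> t _ /=; rewrite lee_fin (le_trans (Re_le_normc _))//.
    by rewrite (le_trans (bT n t n0))// ler_norm.
  - apply: le_integrable idom => //.
      by apply/measurable_EFinP; exact: (measurable_truncated_saddle n w0).2.
    move=> t _ /=; rewrite lee_fin (le_trans (Im_le_normc _))//.
    by rewrite (le_trans (bT n t n0))// ler_norm.
  have eIR (x : R) (z w : R[i]) : Im ('i * (x%:C * z) * w) = x * Re (z * w).
    by case: z w => [z1 z2] [w1 w2]; simpc => /=; ring.
  by rewrite /M eIR.
(* Since w0 ^- 2 - 1 = - 2 s exp (2 i phi), the direction of the limit Gaussian is
   obtained from the vertical one by a rotation of angle phi < pi / 4. *)
pose phi := pi / 4 - alpha / 2.
pose zeta : R[i] := (Num.sqrt (2 * s))%:C * ('i * cexp (phi *i)).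
have ss0 : 0 < Num.sqrt (2 * s) by rewrite sqrtr_gt0 mulr_gt0.
have phi0 : 0 < phi by rewrite /phi; lra.
have pi0 : 0 < pi :> R by exact: pi_gt0.
have phi1 : phi < pi / 2 by rewrite /phi; lra.
have cphi : 0 < cos phi by apply: cos_gt0_pihalf; apply/andP; split; lra.
have sphi : 0 < sin phi by apply: sin_gt0_pihalf; apply/andP; split; lra.
have cs2 : cos phi ^+ 2 - sin phi ^+ 2 = s.
  transitivity (cos (phi + phi)); first by rewrite [cos (phi + phi)]cosD !expr2.
  have -> : phi + phi = - (alpha - pi / 2) by rewrite /phi; lra.
  by rewrite cosN cosBpihalf.
have sc2 : 2 * sin phi * cos phi = a.
  transitivity (sin (phi + phi)); first by rewrite [sin (phi + phi)]sinD; ring.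
  have -> : phi + phi = - alpha + pi / 2 by rewrite /phi; lra.
  by rewrite sinDpihalf cosN.
have zE : zeta = (- (Num.sqrt (2 * s) * sin phi)) +i* (Num.sqrt (2 * s) * cos phi).
  by rewrite /zeta /cexp /= expR0 mul1r; simpc; congr Complex; ring.
have hz : `|Re zeta| < Im zeta.
  rewrite zE /= normrN gtr0_norm ?mulr_gt0// ltr_pM2l//.
  by rewrite -ltr_sqr ?nnegrE ?ltW//; lra.
pose J := Cintegral halfline (fun t => cexp ((t%:C * zeta) ^+ 2 / 2)).
have zeta0 : zeta != 0.
  by apply: contraTneq hz => ->; rewrite /= normr0 ltxx.
have JE : J = (Num.sqrt (pi / 2) / Num.sqrt (2 * s))%:C * cexp ((- phi) *i).
  apply: (mulfI zeta0); rewrite (Cintegral_gauss_ray hz) /zeta.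
  transitivity ((Num.sqrt (2 * s) * (Num.sqrt (pi / 2) / Num.sqrt (2 * s)))%:C *
      'i * (cexp (phi *i) * cexp ((- phi) *i))).
    have -> : cexp (phi *i) * cexp ((- phi) *i) = 1.
      rewrite -cexpD -cexp0; congr cexp; apply/eqP.
      by rewrite eq_complex /= addr0 addrN !eqxx.
    rewrite mulr1 [Num.sqrt (2 * s) * _]mulrC divfK ?gt_eqF//; by simpc.
  by rewrite [(Num.sqrt (2 * s) * _)%:C]rmorphM; ring.
have zz : zeta ^+ 2 = w0 ^- 2 - 1.
  rewrite -exprVn w0V zE.
  have S2 : Num.sqrt (2 * s) ^+ 2 = 2 * s by rewrite sqr_sqrtr ?mulr_ge0// ltW.
  apply/eqP; rewrite eq_complex /=; apply/andP; split; apply/eqP.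
    transitivity (- (Num.sqrt (2 * s) ^+ 2 * (cos phi ^+ 2 - sin phi ^+ 2))).
      by ring.
    by rewrite S2 cs2; lra.
  transitivity (- (Num.sqrt (2 * s) ^+ 2 * (2 * sin phi * cos phi))); first by ring.
  by rewrite S2 sc2; lra.
have z2 t : (t%:C * zeta) ^+ 2 / 2 = (w0 ^- 2 - 1) * t%:C ^+ 2 / 2.
  by rewrite exprMn zz [_ ^+ 2 * _]mulrC.
pose G t := cexp ((t%:C * zeta) ^+ 2 / 2).
have cG : ccontinuous G.
  apply: ccontinuous_cexp; apply: ccontinuousM; last exact: ccontinuous_cst.
  apply: ccontinuousX; apply: ccontinuousM; last exact: ccontinuous_cst.
  by apply: ccontinuous_real => t; exact: cvg_id.
have GN t : G (- t) = G t by rewrite /G [(- t)%:C]rmorphN mulNr sqrrN.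
have JT : Cintegral setT G = 2 * J.
  rewrite /Cintegral (Rintegral_even cG.1); last by move=> t; exact: (congr1 Re (GN t)).
  rewrite (Rintegral_even cG.2); last by move=> t; exact: (congr1 Im (GN t)).
  by rewrite !mulr_natl !mulr2n /J /Cintegral.
have IJ : ccvg (fun n => I n.+1) (2 * J).
  rewrite -JT; apply: (@dominated_Cintegral_cvg _ _ _ _ dom) => //.
  - by move=> n; exact: measurable_truncated_saddle.
  - move=> t _; rewrite /G z2.
    exact: (@ccvg_shiftS _ (fun n => truncated_saddle n w0 t) _
      (@ccvg_truncated_saddle w0 t s0)).
  - by move=> n t _; exact: bT.
have [I1 I2] := IJ.
(* The limit integral does not involve n, so the phase theta n enters the leading
   term only through a factor of modulus 1. *)
pose kappa := Num.sqrt (2 / pi) / amp.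
have k1 : kappa * (2 * (Num.sqrt (pi / 2) / Num.sqrt (2 * s))) = 1.
  rewrite /kappa /amp !sqrtrM ?ltW// !sqrtrV ?ltW//.
  have : 0 < Num.sqrt (2 : R) by rewrite sqrtr_gt0.
  have : 0 < Num.sqrt s by rewrite sqrtr_gt0.
  have : 0 < Num.sqrt (pi : R) by rewrite sqrtr_gt0.
  have : Num.sqrt (2 : R) ^+ 2 = 2 by rewrite sqr_sqrtr.
  move: (Num.sqrt 2) (Num.sqrt s) (Num.sqrt pi) => q S P q2 P0 S0 q0.
  by transitivity (2 / q ^+ 2); [field; rewrite !gt_eqF|rewrite q2 divff].
have kE n : kappa * Re (cexp ((theta n) *i) * (2 * J)) =
    cos (n%:R * (s * a - alpha) - 1 / 2 * (alpha - pi / 2)).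
  have -> : cexp ((theta n) *i) * (2 * J) =
      (2 * (Num.sqrt (pi / 2) / Num.sqrt (2 * s)))%:C * cexp ((theta n - phi) *i).
    have -> : (theta n - phi) *i = (theta n) *i + (- phi) *i by simpc.
    have e2C (r : R) : (2 * r)%:C = 2 * r%:C :> R[i] by rewrite rmorphM rmorph_nat.
    by rewrite cexpD JE e2C; ring.
  have -> : forall (x y : R), Re (x%:C * cexp (y *i)) = x * cos y.
    by move=> x y; rewrite /cexp /= expR0; ring.
  have -> : theta n - phi = - (n%:R * (s * a - alpha) - 1 / 2 * (alpha - pi / 2)).
    by rewrite /theta /phi; lra.
  by rewrite cosN [LHS]mulrA k1 mul1r.
rewrite -cvg_shiftS.
have -> : (fun n => He n.+1 (2 * cos alpha * Num.sqrt n.+1%:R) /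
    (n.+1%:R `^ (n.+1%:R / 2) * Num.sqrt (2 / sin alpha) *
     expR (n.+1%:R * (cos alpha ^+ 2 - 1 / 2))) -
    cos (n.+1%:R * (sin alpha * cos alpha - alpha) - 1 / 2 * (alpha - pi / 2))) =
    (fun n => kappa * Re (cexp ((theta n.+1) *i) * (I n.+1 - 2 * J))).
  apply/funext => n; rewrite HeE// -/s -/a -kE powR_half_mul -/amp.
  have ReMB (x y z : R[i]) : Re (x * (y - z)) = Re (x * y) - Re (x * z).
    by case: x y z => [? ?] [? ?] [? ?] /=; ring.
  rewrite ReMB [RHS]mulrBr; congr (_ - _).
  rewrite /kappa /m; move: (Re _) (sqrtn0 n.+1) (bM n.+1) => X.
  move: (_ ^+ n.+1) (expR _) (Num.sqrt (2 / pi)) => Q E P Q0 E0; field.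
  by rewrite Q0 !gt_eqF.
apply/norm_cvg0P.
have e0 : `|kappa| * (`|Re (I n.+1) - Re (2 * J)| + `|Im (I n.+1) - Im (2 * J)|)
    @[n --> \oo] --> `|kappa| * (0 + 0).
  apply: cvgM; first exact: cvg_cst.
  by apply: cvgD; apply/norm_cvg0P/subr_cvg0.
rewrite addr0 mulr0 in e0.
apply: (@squeeze_cvgr _ _ _ _ (fun=> 0) (fun n => `|kappa| *
  (`|Re (I n.+1) - Re (2 * J)| + `|Im (I n.+1) - Im (2 * J)|))) => //;
  last exact: cvg_cst.
near=> n; apply/andP; split; first exact: normr_ge0.
rewrite normrM ler_wpM2l// (le_trans (Re_le_normc _))// normcM.
have -> : normc (cexp ((theta n.+1) *i)) = 1 by rewrite normc_cexp expR0.
rewrite mul1r (le_trans (normc_le_ReIm _))//.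
Unshelve. all: by end_near. Qed.

Lemma acos_in_quadrant (a : R) : 0 < a < 1 -> 0 < acos a < pi / 2.
Proof.
move=> /andP[a0 a1]; have a11 : -1 <= a <= 1 by apply/andP; split; lra.
rewrite acos_gt0 ?a1 ?andbT; last by lra.
rewrite ltNge; apply/negP => h.
have : cos (acos a) <= 0.
  rewrite -[acos a](subrK (pi / 2)) cosDpihalf oppr_le0 sin_ge0_pi//.
  have := acos_lepi a11; have := @pi_gt0 R => p0 p1.
  by apply/andP; split; lra.
by rewrite acosK ?in_itv//= leNgt a0.
Qed.

Lemma sqrt_div_quarter_powR (x : R) : 0 < x ->
  Num.sqrt 2 / x `^ (1 / 4) = Num.sqrt (2 / Num.sqrt x).
Proof.
move=> x0; have -> : (1 / 4 : R) = 2^-1 * 2^-1 by field.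
rewrite powRrM !powR12_sqrt ?sqrtr_ge0 ?ltW//.
by rewrite sqrtrM// sqrtrV// sqrtr_ge0.
Qed.

End inside.

Unset Implicit Arguments.
Set Strict Implicit.
Set Printing Implicit Defensive.

(* The phase shift - (acos a - pi / 2) / 2 = - acos a / 2 + pi / 4 is the one
   consistent with He (2 * k) 0 having sign (-1) ^ k: at a = 0 the cosine is
   then cos (- n * pi / 2). *)
Theorem theorem3p7 (R : realType) :
  [/\ (forall a : R, 0 < a < 1 ->
        osc_asymp_eq
          (fun n => He n (2 * a * Num.sqrt n%:R))
          (fun n => n%:R `^ (n%:R / 2)
                    * (Num.sqrt 2 / (1 - a ^+ 2) `^ (1 / 4))
                    * expR (n%:R * (a ^+ 2 - 1 / 2)))
          (fun n => cos (n%:R * (a * Num.sqrt (1 - a ^+ 2) - acos a)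
                         - 1 / 2 * (acos a - pi / 2)))),
      (forall alpha : R, 0 < alpha < pi / 2 ->
        osc_asymp_eq
          (fun n => He n (2 * cos alpha * Num.sqrt n%:R))
          (fun n => n%:R `^ (n%:R / 2)
                    * Num.sqrt (2 / sin alpha)
                    * expR (n%:R * (cos alpha ^+ 2 - 1 / 2)))
          (fun n => cos (n%:R * (sin alpha * cos alpha - alpha)
                         - 1 / 2 * (alpha - pi / 2)))),
      (forall a gamma : R, 1 < a -> 0 <= gamma -> a = cosh gamma ->
        asymp_eq \oo
          (fun n => He n (2 * a * Num.sqrt n%:R))
          (fun n => n%:R `^ (n%:R / 2)
                    * expR (n%:R * (gamma + 1 / 2 * expR (- (2 * gamma))))
                    * (expR (gamma / 2) / Num.sqrt (2 * sinh gamma))))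
    & (forall u : R,
        let x n := 2 * Num.sqrt n%:R + n%:R `^ (- (1 / 6)) * u in
        let A n := Num.sqrt (2 * pi) * expR (n%:R / 2) * n%:R `^ (n%:R / 2)
                   * n%:R `^ (1 / 6) * expR (u * n%:R `^ (1 / 3)) in
        (He n (x n) / A n @[n --> \oo] --> Ai u) /\
        (Ai u != 0 ->
         asymp_eq \oo (fun n => He n (x n)) (fun n => A n * Ai u)))].
Proof.
split.
- move=> a a01; have al := acos_in_quadrant a01; have /andP[a0 a1] := a01.
  have a11 : -1 <= a <= 1 by apply/andP; split; lra.
  have x0 : 0 < 1 - a ^+ 2 by rewrite subr_gt0 expr_lt1// ltW.
  have := He_asymp_inside al; rewrite acosK ?in_itv//= sin_acos//.
  congr osc_asymp_eq; apply/funext => n.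
    by rewrite sqrt_div_quarter_powR.
  by rewrite [a * _]mulrC.
- exact: He_asymp_inside.
- exact: He_asymp_outside.
- exact: He_asymp_edge.
Qed.
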